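(* Let $\mathcal{S}$ be the set of all real $5\times 5$ completely pivoted matrices $A$ of the form $$A=\begin{bmatrix} 1 & 1 & a_{13} & a_{14} & a_{15}\\ x & a_{22} & a_{23} & -1 & 1\\ -1 & a_{32} & a_{33} & -1 & -1\\ y & a_{42} & 1 & 1 & 1\\ z & -1 & 1 & -1 & 1\end{bmatrix}$$ (with $x,y,z,a_{13},a_{14},a_{15},a_{22},a_{23},a_{32},a_{33},a_{42}$ arbitrary reals) whose Gaussian elimination matrices satisfy the equalities $$A^{(2)}_{32}=A^{(2)}_{22},\quad A^{(2)}_{34}=-A^{(2)}_{22},\quad A^{(2)}_{43}=A^{(2)}_{22},\quad A^{(2)}_{52}=-A^{(2)}_{22},$$ $$A^{(3)}_{35}=-A^{(3)}_{33},\quad A^{(3)}_{43}=A^{(3)}_{33},\quad A^{(3)}_{54}=-A^{(3)}_{33},$$ $$A^{(4)}_{45}=A^{(4)}_{44},\quad A^{(4)}_{54}=-A^{(4)}_{44},\quad A^{(4)}_{55}=A^{(4)}_{44}.$$ Then the largest growth factor $\max_{A\in\mathcal{S}} g(A)$ is exactly the real root of the polynomial $P_5$ (defined in the context) that is approximately $4.1325170786\ldots$, namely the unique real root of $P_5$ in the interval $(4,5)$.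
   Context: For a real $n\times n$ matrix $A$ and $k=1,\dots,n$, set $A^{(k)} := A_{k:n,k:n} - A_{k:n,1:k-1}\,[A_{1:k-1,1:k-1}]^{-1} A_{1:k-1,k:n}$, where $A_{i:j,k:\ell}$ is the submatrix with rows $i,\dots,j$ and columns $k,\dots,\ell$; the entries of $A^{(k)}$ are indexed by $i,j\in\{k,\dots,n\}$ (so $A^{(1)}=A$ and $A^{(k)}$ is the matrix remaining after $k-1$ steps of Gaussian elimination; the relevant leading principal submatrices are assumed invertible). $A$ is completely pivoted if $|A^{(k)}_{i,j}|\le |A^{(k)}_{k,k}|$ for all $i,j=k,\dots,n$, $k=1,\dots,n-1$. For such $A=LU$ ($L$ unit lower triangular, $U$ upper triangular with $U_{kk}=A^{(k)}_{kk}$) the growth factor is $g(A)=\max\{\|L\|_{\max},\|U\|_{\max}/\|A\|_{\max}\}$, $\|\cdot\|_{\max}$ denoting the largest absolute value of an entry. $P_5(g)=\sum_{k=0}^{61} c_k g^k$ with integer coefficients: $c_0=-400768351683901408958416200638054732473753927680$, $c_1=4485865416851125743788230145233574388718469382144$, $c_2=-24514764764411504983475981567602588918013382098944$, $c_3=87217226729799564487654554570961532637620826275840$, $c_4=-227272096308101830763401243729746552751035059798016$, $c_5=462709819431332579135613503090210881152929786494976$, $c_6=-766717614581304313114392121166832616680006210289664$, $c_7=1063584436778076241182112335678621890599851466424320$, $c_8=-1260890928707415271320049672620311457803946132766720$, $c_9=1297738577606655379676433338360545479999727889022976$, $c_{10}=-1174034757320339655369158795901049591606791293108224$, $c_{11}=942963464577089526044422206269395994977092205805568$,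 $c_{12}=-677934188506657333601022620611924661223810387673088$, $c_{13}=439257245648213960218425406267346647338070336077824$, $c_{14}=-257972856502979631073226298004753211978646395289600$, $c_{15}=137990608561232610866439277823535118550017691877376$, $c_{16}=-67501782245716434625321022717049489901181623861248$, $c_{17}=30300948936890380444641188810690357840398421852160$, $c_{18}=-12517004528640474114410312100200354935951234957312$, $c_{19}=4769063904740641993461152447863884474835999391744$, $c_{20}=-1678801195187379807996886928950958962405971853312$, $c_{21}=546626688596819879421936148562972655095260381184$, $c_{22}=-164708488081737671005260911304389856200929312768$, $c_{23}=45913441353285356544812597189623621359713124352$, $c_{24}=-11824394908442237813782015042429910964838072320$, $c_{25}=2805505141981336865142529528869875207720927232$, $c_{26}=-610122837879497813508978054510894441606152192$, $c_{27}=120517644367496052573488222809065538013102080$, $c_{28}=-21259613889629901444312810746680889153945600$, $c_{29}=3232473902649233225492038672001558428778496$, $c_{30}=-385658581119287455693748758468032752254976$, $c_{31}=22806308021126342831010091967753643622400$, $c_{32}=4894535361089103056466100216447232901120$, $c_{33}=-2321369271980741328279078542236324986880$, $c_{34}=601696561599723882176326969201384226816$, $c_{35}=-123775438994232337878919408695562469376$, $c_{36}=21961720969887997312065520856381521920$, $c_{37}=-3468454832875402800794241505433747456$, $c_{38}=494585628535060280610858619094695936$, $c_{39}=-64096987281967089485798296793382912$, $c_{40}=7566621187666403129807306257072128$, $c_{41}=-812991033858742708150732650971136$, $c_{42}=79218174622382297258263303946240$, $c_{43}=-6951821319653222073914715275264$, $c_{44}=542828623292663115763310526464$, $c_{45}=-36902811774200980940618924032$,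 $c_{46}=2088035191940616804066754560$, $c_{47}=-86850177265000967745748992$, $c_{48}=1176129227591098999291904$, $c_{49}=223725965850750547116032$, $c_{50}=-29310655078216507848704$, $c_{51}=2327920657178572930048$, $c_{52}=-143068110048321554432$, $c_{53}=7211069563930583552$, $c_{54}=-302975406829565568$, $c_{55}=10602327706308288$, $c_{56}=-305386806375072$, $c_{57}=7079217962544$, $c_{58}=-127283265864$, $c_{59}=1668783060$, $c_{60}=-14211126$, $c_{61}=59049$. *)

(* Defs.v *)
From Stdlib Require Import BinNums PArith.
From HB Require Import structures.
From mathcomp Require Import all_boot all_order all_algebra.
From mathcomp Require Import all_classical all_reals.

Set Implicit Arguments.
Unset Strict Implicit.
Unset Printing Implicit Defensive.

Import Order.TTheory GRing.Theory Num.Theory.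
Local Open Scope ring_scope.

Section Defs.
Variable R : realType.

(* Embedding of binary integers (Stdlib Z) into R, so that the huge
   coefficients of P_5 can be written as literals. *)
Fixpoint posR (p : positive) : R :=
  match p with
  | xH => 1
  | xO q => 2 * posR q
  | xI q => 2 * posR q + 1
  end.

Definition zR (z : Z) : R :=
  match z with
  | Z0 => 0
  | Zpos p => posR p
  | Zneg p => - posR p
  end.

Definition P5_coeffs : seq Z := [::
  Zneg 400768351683901408958416200638054732473753927680%positive;
  Zpos 4485865416851125743788230145233574388718469382144%positive;
  Zneg 24514764764411504983475981567602588918013382098944%positive;
  Zpos 87217226729799564487654554570961532637620826275840%positive;
  Zneg 227272096308101830763401243729746552751035059798016%positive;
  Zpos 462709819431332579135613503090210881152929786494976%positive;
  Zneg 766717614581304313114392121166832616680006210289664%positive;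
  Zpos 1063584436778076241182112335678621890599851466424320%positive;
  Zneg 1260890928707415271320049672620311457803946132766720%positive;
  Zpos 1297738577606655379676433338360545479999727889022976%positive;
  Zneg 1174034757320339655369158795901049591606791293108224%positive;
  Zpos 942963464577089526044422206269395994977092205805568%positive;
  Zneg 677934188506657333601022620611924661223810387673088%positive;
  Zpos 439257245648213960218425406267346647338070336077824%positive;
  Zneg 257972856502979631073226298004753211978646395289600%positive;
  Zpos 137990608561232610866439277823535118550017691877376%positive;
  Zneg 67501782245716434625321022717049489901181623861248%positive;
  Zpos 30300948936890380444641188810690357840398421852160%positive;
  Zneg 12517004528640474114410312100200354935951234957312%positive;
  Zpos 4769063904740641993461152447863884474835999391744%positive;
  Zneg 1678801195187379807996886928950958962405971853312%positive;
  Zpos 546626688596819879421936148562972655095260381184%positive;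
  Zneg 164708488081737671005260911304389856200929312768%positive;
  Zpos 45913441353285356544812597189623621359713124352%positive;
  Zneg 11824394908442237813782015042429910964838072320%positive;
  Zpos 2805505141981336865142529528869875207720927232%positive;
  Zneg 610122837879497813508978054510894441606152192%positive;
  Zpos 120517644367496052573488222809065538013102080%positive;
  Zneg 21259613889629901444312810746680889153945600%positive;
  Zpos 3232473902649233225492038672001558428778496%positive;
  Zneg 385658581119287455693748758468032752254976%positive;
  Zpos 22806308021126342831010091967753643622400%positive;
  Zpos 4894535361089103056466100216447232901120%positive;
  Zneg 2321369271980741328279078542236324986880%positive;
  Zpos 601696561599723882176326969201384226816%positive;
  Zneg 123775438994232337878919408695562469376%positive;
  Zpos 21961720969887997312065520856381521920%positive;
  Zneg 3468454832875402800794241505433747456%positive;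
  Zpos 494585628535060280610858619094695936%positive;
  Zneg 64096987281967089485798296793382912%positive;
  Zpos 7566621187666403129807306257072128%positive;
  Zneg 812991033858742708150732650971136%positive;
  Zpos 79218174622382297258263303946240%positive;
  Zneg 6951821319653222073914715275264%positive;
  Zpos 542828623292663115763310526464%positive;
  Zneg 36902811774200980940618924032%positive;
  Zpos 2088035191940616804066754560%positive;
  Zneg 86850177265000967745748992%positive;
  Zpos 1176129227591098999291904%positive;
  Zpos 223725965850750547116032%positive;
  Zneg 29310655078216507848704%positive;
  Zpos 2327920657178572930048%positive;
  Zneg 143068110048321554432%positive;
  Zpos 7211069563930583552%positive;
  Zneg 302975406829565568%positive;
  Zpos 10602327706308288%positive;
  Zneg 305386806375072%positive;
  Zpos 7079217962544%positive;
  Zneg 127283265864%positive;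
  Zpos 1668783060%positive;
  Zneg 14211126%positive;
  Zpos 59049%positive].

Definition P5 (g : R) : R :=
  \sum_(k < 62) zR (nth Z0 P5_coeffs k) * g ^+ k.

(* 0-based entry access of an n x n matrix by natural numbers
   (out of range indices give 0; never used out of range below). *)
Definition ent (n : nat) (A : 'M[R]_n) (i j : nat) : R :=
  match insub i, insub j with
  | Some i', Some j' => A i' j'
  | _, _ => 0
  end.

(* A_{1:m,1:m}, A_{i,1:m}, A_{1:m,j}  (here i, j are 0-based) *)
Definition lead (n : nat) (A : 'M[R]_n) (m : nat) : 'M[R]_m :=
  \matrix_(p < m, q < m) ent A p q.
Definition rowpart (n : nat) (A : 'M[R]_n) (m i : nat) : 'rV[R]_m :=
  \row_(q < m) ent A i q.
Definition colpart (n : nat) (A : 'M[R]_n) (m j : nat) : 'cV[R]_m :=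
  \col_(p < m) ent A p j.

(* schur A k i j = A^{(k)}_{i,j} with the paper's 1-based indices
   k, i, j (meaningful for 1 <= k <= i, j <= n):
   A^{(k)} = A_{k:n,k:n} - A_{k:n,1:k-1} [A_{1:k-1,1:k-1}]^{-1} A_{1:k-1,k:n}. *)
Definition schur (n : nat) (A : 'M[R]_n) (k i j : nat) : R :=
  ent A i.-1 j.-1 -
  (rowpart A k.-1 i.-1 *m invmx (lead A k.-1) *m colpart A k.-1 j.-1) 0 0.

(* The relevant leading principal submatrices (orders 1..n-1) are invertible,
   so that A^{(1)}, ..., A^{(n)} are well defined. *)
Definition lead_invertible (n : nat) (A : 'M[R]_n) : Prop :=
  forall m : nat, (1 <= m)%N -> (m <= n.-1)%N -> lead A m \in unitmx.

Definition completely_pivoted (n : nat) (A : 'M[R]_n) : Prop :=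
  forall k i j : nat, (1 <= k)%N -> (k <= n.-1)%N ->
    (k <= i <= n)%N -> (k <= j <= n)%N ->
    `|schur A k i j| <= `|schur A k k k|.

Definition maxnorm (m n : nat) (M : 'M[R]_(m, n)) : R :=
  \big[Num.max/0]_(i < m) \big[Num.max/0]_(j < n) `|M i j|.

(* The LU factors A = L U of Gaussian elimination (no pivoting):
   L unit lower triangular with L_{ik} = A^{(k)}_{ik} / A^{(k)}_{kk} (i > k),
   U upper triangular with U_{kj} = A^{(k)}_{kj} (j >= k). *)
Definition Lfac (n : nat) (A : 'M[R]_n) : 'M[R]_n :=
  \matrix_(i < n, j < n)
    if i == j then 1
    else if (j < i)%N then schur A j.+1 i.+1 j.+1 / schur A j.+1 j.+1 j.+1
    else 0.
Definition Ufac (n : nat) (A : 'M[R]_n) : 'M[R]_n :=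
  \matrix_(i < n, j < n) if (i <= j)%N then schur A i.+1 i.+1 j.+1 else 0.

Definition growth (n : nat) (A : 'M[R]_n) : R :=
  Num.max (maxnorm (Lfac A)) (maxnorm (Ufac A) / maxnorm A).

Definition inS (A : 'M[R]_5) : Prop :=
  lead_invertible A /\ completely_pivoted A /\
  (* fixed entries (0-based); x, y, z and the a_ij entries are free *)
  (ent A 0 0 = 1 /\ ent A 0 1 = 1 /\
   ent A 1 3 = -1 /\ ent A 1 4 = 1 /\
   ent A 2 0 = -1 /\ ent A 2 3 = -1 /\ ent A 2 4 = -1 /\
   ent A 3 2 = 1 /\ ent A 3 3 = 1 /\ ent A 3 4 = 1 /\
   ent A 4 1 = -1 /\ ent A 4 2 = 1 /\ ent A 4 3 = -1 /\ ent A 4 4 = 1) /\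
  (* elimination equalities, paper's 1-based indices *)
  (schur A 2 3 2 = schur A 2 2 2 /\ schur A 2 3 4 = - schur A 2 2 2 /\
   schur A 2 4 3 = schur A 2 2 2 /\ schur A 2 5 2 = - schur A 2 2 2) /\
  (schur A 3 3 5 = - schur A 3 3 3 /\ schur A 3 4 3 = schur A 3 3 3 /\
   schur A 3 5 4 = - schur A 3 3 3) /\
  (schur A 4 4 5 = schur A 4 4 4 /\ schur A 4 5 4 = - schur A 4 4 4 /\
   schur A 4 5 5 = schur A 4 4 4).

End Defs.

(* Main.v *)
Require Import Defs.
From Stdlib Require Import ZArith.
From HB Require Import structures.
From mathcomp Require Import all_boot all_order all_algebra.
From mathcomp Require Import all_classical all_reals.
From mathcomp Require Import topology normedtype derive.
From mathcomp Require Import ssrZ ring lra.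

Set Implicit Arguments.
Unset Strict Implicit.
Unset Printing Implicit Defensive.

Import Order.TTheory GRing.Theory Num.Theory.
Local Open Scope ring_scope.

(* With u = A^(2)_22 - 1 and x = A_21, the prescribed equalities determine all
   other entries of A as rational functions of u and x, leave one polynomial
   relation, and give pivots 1, 1 + u, 2 - u (u + x), r and 2 r, where
   r = 2 + 2 v and v = - u (u + x) / ((2 - u) (1 + u)). So S is an arc of a plane
   curve H(u, v) = 0, and the growth factor is 4 + 4 v wherever v >= 0. Complete
   pivoting confines the points with v > 0 to 0 <= u <= 1, v <= 1/9; there H is
   positive for v >= 0.0332, and the zeros with v >= 0.033 have u in
   (0.42, 0.49), where all pivoting inequalities hold. Hence v has a maximum on
   the curve, attained at an interior point where also dH/du = 0, and eliminating
   u from H = dH/du = 0 yields v^8 (1 + 2 v)^2 P5(4 + 4 v) = 0. Finally P5 is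
   injective on [4, 5]. *)

(** The root is an algebraic number of high degree, so it is never computed: compactness supplies
    the maximizer and the eliminant identifies its height afterwards. The height is v = 0.033129...,
    and 33/1000 and 83/2500 are convenient rationals on either side of it. Zeros with v below
    33/1000 never compete with it, so only the thin strip above needs analysis. Every sign condition
    (positivity of H, estimates in the box, injectivity of [P5]) becomes a bisection over integer
    coefficient lists, and the elimination becomes one polynomial identity checked by computation.
    An arbitrary member of S may make a denominator vanish (u = 0, u = 1 or x = -1). The passage
    from matrices to the curve therefore uses the multiples T, Y and B of the unknowns; division by
    these quantities occurs only in the box, where they are bounded away from zero. *)

(** * Certified bounds for integer polynomials in two variables *)

Fixpoint addp (T : Type) (add : T -> T -> T) (p q : seq T) : seq T :=
  match p, q with
  | [::], _ => q
  | _, [::] => p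
  | a :: p', b :: q' => add a b :: addp add p' q'
  end.

(** Polynomials are dense coefficient lists, lowest degree first: [seq Z] stands for Z[v] and
    [seq (seq Z)] for polynomials in u over Z[v]. Trailing zeros are allowed. *)
Definition add1 := addp Z.add.
Definition add2 := addp add1.

Fixpoint mul1 (p q : seq Z) : seq Z :=
  if p is c :: p' then add1 (map (Z.mul c) q) (Z0 :: mul1 p' q) else [::].

Fixpoint comp1 (p q : seq Z) : seq Z :=
  if p is c :: p' then add1 [:: c] (mul1 q (comp1 p' q)) else [::].

Fixpoint mul2 (p q : seq (seq Z)) : seq (seq Z) :=
  if p is r :: p' then add2 (map (mul1 r) q) ([::] :: mul2 p' q) else [::].

(** Exchanges the two variables, so that operations on the outer one serve for both. *)
Fixpoint swap2 (p : seq (seq Z)) : seq (seq Z) :=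
  if p is r :: p' then
    add2 (map (fun c => [:: c]) r) (map (cons Z0) (swap2 p'))
  else [::].

(** For nonempty p this is p(u/2) times 2 to the power [size p - 1]. The factor keeps the
    coefficients integral and does not affect signs. It rescales the left half of a cell to the unit
    square; [shift2] of the result gives the right half. *)
Fixpoint half2 (p : seq (seq Z)) : seq (seq Z) :=
  if p is r :: p' then iter (size p') (map Z.double) r :: half2 p' else [::].

Fixpoint shift2 (p : seq (seq Z)) : seq (seq Z) :=
  if p is r :: p' then let s := shift2 p' in add2 (r :: s) s else [::].

(** The least partial sum of the coefficients. It bounds the polynomial from below on [0, 1] by Abel
    summation, because the powers of v decrease. *)
Fixpoint low1 (p : seq Z) : Z :=
  if p is c :: p' then Z.add c (Z.min Z0 (low1 p')) else Z0.

Fixpoint low2 (p : seq (seq Z)) : Z :=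
  if p is r :: p' then Z.add (low1 r) (Z.min Z0 (low2 p')) else Z0.

(* Bisects the unit square along the directions [ds] ([true] splits the outer
   variable) until on every cell some member of [ps] has a positive lower bound;
   hypotheses are fed in negated, as further members of [ps]. *)
Fixpoint bisect_pos (ds : seq bool) (ps : seq (seq (seq Z))) : bool :=
  if has (fun p => Z.ltb Z0 (low2 p)) ps then true else
  if ds is d :: ds' then
    let qs := map half2 (if d then ps else map swap2 ps) in
    let rs := map shift2 qs in
    if bisect_pos ds' (if d then qs else map swap2 qs) then
      bisect_pos ds' (if d then rs else map swap2 rs)
    else false
  else false.

(** Lists with trailing zeros have no unique form, so an identity is tested by checking that all
    coefficients of a difference vanish. *)
Definition zero1 (p : seq Z) : bool := all (Z.eqb Z0) p.

(** Reified expressions: [norm] computes their integer coefficients, [den] reads them over the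
    reals. *)
Inductive pexp : Type :=
  | PU | PV | PC of Z | PAdd of pexp & pexp | PSub of pexp & pexp
  | PMul of pexp & pexp.

Fixpoint norm (e : pexp) : seq (seq Z) :=
  match e with
  | PU => [:: [::]; [:: Zpos 1]]
  | PV => [:: [:: Z0; Zpos 1]]
  | PC c => [:: [:: c]]
  | PAdd a b => add2 (norm a) (norm b)
  | PSub a b => add2 (norm a) (map (map Z.opp) (norm b))
  | PMul a b => mul2 (norm a) (norm b)
  end.

(* [tails p] are the coefficients of [(p a - p b) / (a - b)]. *)
Fixpoint tails (p : seq Z) : seq (seq Z) :=
  if p is _ :: p' then p' :: tails p' else [::].

Fixpoint deriv2 (p : seq (seq Z)) : seq (seq Z) :=
  if p is _ :: p' then add2 p' ([::] :: deriv2 p') else [::].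

(** * Evaluation over the reals and soundness of the bisection *)

Section Eval.
Variable R : realType.
Implicit Types (u v : R).

Lemma zRE (z : Z) : zR R z = (int_of_Z z)%:~R.
Proof.
have posRE (p : positive) : posR R p = (Pos.to_nat p)%:R.
  elim: p => [p IH|p IH|//] /=; rewrite IH.
    by rewrite Pos2Nat.inj_xI -[in RHS]natr1 multE natrM.
  by rewrite Pos2Nat.inj_xO multE natrM.
case: z => [//|p|p] /=; rewrite posRE //.
by rewrite NegzE prednK ?rmorphN //; have := Pos2Nat.is_pos p => /ssrnat.ltP.
Qed.

Lemma zRD a b : zR R (Z.add a b) = zR R a + zR R b.
Proof. by rewrite !zRE -rmorphD -(rmorphD int_of_Z). Qed.

Lemma zRM a b : zR R (Z.mul a b) = zR R a * zR R b.
Proof. by rewrite !zRE -rmorphM -(rmorphM int_of_Z). Qed.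

Lemma zRN a : zR R (Z.opp a) = - zR R a.
Proof. by rewrite !zRE -rmorphN -(rmorphN int_of_Z). Qed.

Lemma zR_gt0 a : Z.ltb Z0 a -> 0 < zR R a.
Proof.
case: a => // p _ /=; elim: p => [p IH|p IH|] //=; last by rewrite mulr_gt0.
by rewrite addr_gt0 ?mulr_gt0.
Qed.

Lemma zR_min0 a : zR R (Z.min Z0 a) = Num.min 0 (zR R a).
Proof.
case: a => [|p|p] /=; rewrite ?minxx //.
  by rewrite (min_idPl _) // ltW // (@zR_gt0 (Zpos p)).
by rewrite (min_idPr _) // oppr_le0 ltW // (@zR_gt0 (Zpos p)).
Qed.

Fixpoint ev1 (p : seq Z) v : R :=
  if p is c :: p' then zR R c + v * ev1 p' v else 0.

Fixpoint ev2 (p : seq (seq Z)) u v : R :=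
  if p is r :: p' then ev1 r v + u * ev2 p' u v else 0.

Fixpoint den (e : pexp) u v : R :=
  match e with
  | PU => u
  | PV => v
  | PC c => zR R c
  | PAdd a b => den a u v + den b u v
  | PSub a b => den a u v - den b u v
  | PMul a b => den a u v * den b u v
  end.

Lemma ev1_add p q v : ev1 (add1 p q) v = ev1 p v + ev1 q v.
Proof.
elim: p q => [|a p IH] [|b q] /=; rewrite ?(add0r, addr0) //.
rewrite -/(add1 p q) IH zRD; ring.
Qed.

Lemma ev2_add p q u v : ev2 (add2 p q) u v = ev2 p u v + ev2 q u v.
Proof.
elim: p q => [|a p IH] [|b q] /=; rewrite ?(add0r, addr0) //.
rewrite -/(add2 p q) IH ev1_add; ring.
Qed.

Lemma ev1_scale c p v : ev1 (map (Z.mul c) p) v = zR R c * ev1 p v.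
Proof. by elim: p => [|a p IH] /=; rewrite ?mulr0 // IH zRM; ring. Qed.

Lemma ev2_zscale c p u v :
  ev2 (map (map (Z.mul c)) p) u v = zR R c * ev2 p u v.
Proof. by elim: p => [|a p IH] /=; rewrite ?mulr0 // IH ev1_scale; ring. Qed.

Lemma ev1_mul p q v : ev1 (mul1 p q) v = ev1 p v * ev1 q v.
Proof.
elim: p => [|c p IH]; first by rewrite /= mul0r.
by rewrite [mul1 _ _]/= ev1_add ev1_scale /= IH; ring.
Qed.

Lemma ev1_comp p q v : ev1 (comp1 p q) v = ev1 p (ev1 q v).
Proof.
elim: p => [//|c p IH]; rewrite [comp1 _ _]/= ev1_add ev1_mul IH /=; ring.
Qed.

Lemma ev2_scale r p u v : ev2 (map (mul1 r) p) u v = ev1 r v * ev2 p u v.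
Proof. by elim: p => [|a p IH] /=; rewrite ?mulr0 // IH ev1_mul; ring. Qed.

Lemma ev2_mul p q u v : ev2 (mul2 p q) u v = ev2 p u v * ev2 q u v.
Proof.
elim: p => [|c p IH]; first by rewrite /= mul0r.
by rewrite [mul2 _ _]/= ev2_add ev2_scale /= IH; ring.
Qed.

Lemma ev2_opp p u v : ev2 (map (map Z.opp) p) u v = - ev2 p u v.
Proof.
have ev1_opp r : ev1 (map Z.opp r) v = - ev1 r v.
  by elim: r => [|c r IH] /=; rewrite ?oppr0 // IH zRN; ring.
by elim: p => [|r p IH] /=; rewrite ?oppr0 // IH ev1_opp; ring.
Qed.

Lemma ev2_swap p u v : ev2 (swap2 p) v u = ev2 p u v.
Proof.
elim: p => [//|r p IH]; rewrite [swap2 _]/= ev2_add /= -IH; congr (_ + _).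
  elim: r => [//|c r IHr] /=; rewrite IHr; ring.
by elim: (swap2 p) => [|s q IHq] /=; rewrite ?mulr0 // IHq; ring.
Qed.

(** The extra factor 2 on the left avoids the exponent [size p - 1], and so covers the empty
    list. *)
Lemma ev2_half p u v :
  2 * ev2 (half2 p) u v = 2 ^+ size p * ev2 p (u / 2) v.
Proof.
elim: p => [|r p IH] /=; first by rewrite !mulr0.
have -> : ev1 (iter (size p) (map Z.double) r) v = 2 ^+ size p * ev1 r v.
  elim: (size p) => [|n IHn] /=; first by rewrite expr0 mul1r.
  rewrite exprS -mulrA -IHn.
  elim: (iter _ _ _) => [|c s IHs] /=; first by rewrite mulr0.
  by rewrite IHs Z.double_spec zRM /=; ring.
have {}IH : ev2 (half2 p) u v = 2 ^+ size p * ev2 p (u / 2) v / 2.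
  by rewrite -IH; field.
by rewrite IH exprS; field.
Qed.

Lemma ev2_shift p u v : ev2 (shift2 p) u v = ev2 p (u + 1) v.
Proof.
elim: p => [//|r p IH]; rewrite [shift2 _]/= ev2_add /= IH; ring.
Qed.

Lemma low1_le p v : 0 <= v <= 1 -> zR R (low1 p) <= ev1 p v.
Proof.
move=> /andP[v0 v1]; elim: p => [//|c p IH] /=.
rewrite zRD lerD2l zR_min0 ge_min.
have [h|h] := leP 0 (ev1 p v); first by rewrite mulr_ge0.
by apply/orP; right; apply: le_trans IH _; rewrite ler_nMl ?h.
Qed.

Lemma low2_le p u v : 0 <= u <= 1 -> 0 <= v <= 1 ->
  zR R (low2 p) <= ev2 p u v.
Proof.
move=> /andP[u0 u1] hv; elim: p => [//|r p IH] /=.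
rewrite zRD lerD ?low1_le // zR_min0 ge_min.
have [h|h] := leP 0 (ev2 p u v); first by rewrite mulr_ge0.
by apply/orP; right; apply: le_trans IH _; rewrite ler_nMl ?h.
Qed.

Lemma bisect_pos_sound ds ps u v : 0 <= u <= 1 -> 0 <= v <= 1 ->
  bisect_pos ds ps -> has (fun p => 0 < ev2 p u v) ps.
Proof.
(* One split of the outer variable; a split of the inner one is reduced to it by [swap2]. *)
have step qs x y : 0 <= x <= 1 ->
    (forall x', 0 <= x' <= 1 -> has (fun p => 0 < ev2 p x' y) (map half2 qs)) ->
    (forall x', 0 <= x' <= 1 ->
       has (fun p => 0 < ev2 p x' y) (map shift2 (map half2 qs))) ->
    has (fun p => 0 < ev2 p x y) qs.
  move=> /andP[x0 x1] hL hR.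
  have E p x' : (0 < ev2 (half2 p) x' y) = (0 < ev2 p (x' / 2) y).
    by rewrite -(@pmulr_rgt0 _ 2) // ev2_half pmulr_rgt0 // exprn_gt0.
  have [xh|xh] := leP x (1 / 2).
    have /hL : 0 <= 2 * x <= 1 by apply/andP; split; lra.
    rewrite has_map; apply: sub_has => p /=.
    by rewrite E (_ : 2 * x / 2 = x) //; field.
  have /hR : 0 <= 2 * x - 1 <= 1 by apply/andP; split; lra.
  rewrite !has_map; apply: sub_has => p /=.
  by rewrite ev2_shift E (_ : (2 * x - 1 + 1) / 2 = x) //; field.
elim: ds ps u v => [|d ds IH] ps u v hu hv /=; case: ifP => [h _|_ //].
- by apply: sub_has h => p /zR_gt0 /lt_le_trans; apply; exact: low2_le.
- by apply: sub_has h => p /zR_gt0 /lt_le_trans; apply; exact: low2_le.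
have swapE qs x y :
    has (fun p => 0 < ev2 p x y) (map swap2 qs)
    = has (fun p => 0 < ev2 p y x) qs.
  by rewrite has_map; apply: eq_has => p /=; rewrite ev2_swap.
case: ifP => // cL cR; case: d cL cR => cL cR.
  by apply: step => // x' hx'; exact: IH.
by rewrite -swapE; apply: step => // x' hx'; rewrite -swapE; exact: IH.
Qed.

Lemma norm_den e u v : ev2 (norm e) u v = den e u v.
Proof.
elim: e => [||c|a IHa b IHb|a IHa b IHb|a IHa b IHb] /=.
- by ring.
- by ring.
- by ring.
- by rewrite ev2_add IHa IHb.
- by rewrite ev2_add ev2_opp IHa IHb.
- by rewrite ev2_mul IHa IHb.
Qed.

Lemma bisect_pos_den ds es u v : bisect_pos ds (map norm es) ->
  0 <= u <= 1 -> 0 <= v <= 1 -> has (fun e => 0 < den e u v) es.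
Proof.
move=> c hu hv; have := bisect_pos_sound hu hv c; rewrite has_map.
by apply: sub_has => e /=; rewrite norm_den.
Qed.

Lemma ev2_tails p u v : ev1 p u - ev1 p v = (u - v) * ev2 (tails p) v u.
Proof.
elim: p => [|c p IH] /=; first by rewrite subr0 mulr0.
transitivity ((u - v) * ev1 p u + v * (ev1 p u - ev1 p v)); first by ring.
by rewrite IH; ring.
Qed.

End Eval.

(** * The curve *)

Local Open Scope Z_scope.

Definition W_exp : pexp := PSub (PAdd (PC 2) PU) (PMul PU PU).
Definition W2_exp : pexp := PSub W_exp (PC 2).
Definition B_exp : pexp := PSub (PMul W_exp (PSub (PC 1) PV)) (PC 2).
Definition T_exp : pexp :=
  PAdd (PMul W2_exp (PSub (PC 1) (PMul (PC 2) PV)))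
       (PMul (PMul (PC 4) (PMul PV PV)) W_exp).
Definition Y_exp : pexp :=
  PSub (PMul (PMul (PMul (PC (-2)) PV) B_exp)
          (PSub (PSub W_exp (PC 4)) (PMul (PMul (PC 2) PV) W_exp)))
       (PMul PU T_exp).
Definition Z_exp : pexp :=
  PSub B_exp (PMul (PMul PV W2_exp) (PAdd (PC 2) (PMul W_exp PV))).
Definition H_exp : pexp :=
  PAdd (PMul (PMul T_exp Y_exp) Z_exp)
    (PMul (PMul B_exp W2_exp)
       (PAdd (PMul (PMul PU (PMul PU PU)) T_exp)
          (PMul (PSub (PSub PU (PC 1)) (PMul W_exp PV)) Y_exp))).

Definition Hpoly : seq (seq Z) := Eval vm_compute in norm H_exp.

(* Cofactors, as polynomials in [u] over [Z[v]], that eliminate [u] from [Hf] and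
   its [u]-derivative: the last row of the adjugate of their Sylvester matrix,
   divided by its content. *)
Definition cofactor_H : seq (seq Z) := [::
  [:: 0; 0; 0; -16192; 837568; -13824032; 116900096; -847691552; 13465065600;
   -147714285856; 1116236805504; -2026846798752; -2622782035456;
   130433426085952; 392961823738112; -292264809467008; 2659564696420096;
   9066669642214400; -30120671684257280; -63190843000788992;
   98507542799150080; -226795891188370944; -521550477698172928;
   3754865153082185216; -1282220680838977536; -2773760767048883200;
   23432171054097387520; -131113960243033999360; 106650163720010739712;
   305744760600352346112; -734740976426676797440; 2296254724813138477056;
   -3407493528180919386112; -5080894758261883191296; 19734904093258790436864;
   -28643960260253127507968; 32583086471766617096192; 21237593960764587180032;
   -174896343430794968432640; 278685286584845987479552;
   -241422294445090800140288; 169816492751111095058432;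
   94413766948143887810560; -714109461349225969221632;
   1300590104832344092311552; -1796606600245292570771456;
   2576051830261713633017856; -3121962940178393204785152;
   3111185228002891919261696; -3147464622269450680270848;
   2982331076556501194637312; -2324843696742991484944384;
   1828442035302829884702720; -1488965453874388480819200;
   955775519876845272039424; -558149571193856222822400;
   412624980326499838066688; -232078507480896371687424;
   92527795935373869187072; -63750774988055607508992; 30786917256700484386816;
   -5043471118250648010752; 7643424209768630190080; -134161953348535713792;
   160439358487248502784; -188482521850686996480; -6944379101591371776;
   82617809486437416960; 5242453849049923584; -57711166318706688;
   346266997912240128];
  [:: 0; 0; 528; -346224; 10502720; -23709872; 326444000; -5972090096;
   94837288256; -130430671600; -125117195344; 22818838908672; 4514490891712;
   -438267267954432; -367180871981248; 844317728087424; -12331342970830336;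
   -16018984226862336; 119592050270222848; 81811368407063808;
   -292261500231546368; 1172322470994744576; -108567376912011520;
   -10672404731340649472; 6944769232057115648; -1378491376268068864;
   -31709442980280112128; 370655868601685368832; -451567502438545721344;
   -679569629803002392576; 2068563707278533197824; -7191387008102220808192;
   13955109136182080118784; 6472580559887341092864; -55345064373859671277568;
   102621609630327891296256; -143300867154082707865600;
   16216225621827744497664; 447835870987921267556352;
   -890186201934464616497152; 896192245883209952788480;
   -544801479943942228148224; -394884841951005773135872;
   2156087352784723005931520; -3726380633138458175995904;
   4618519512307627839193088; -5556319267319475483967488;
   5917068577195831750295552; -5313276524498878472388608;
   4803498150165087592120320; -4210696703609997851885568;
   3122599184100738140733440; -2254968391628118699278336;
   1791737676960323340337152; -1222460529666075513585664;
   690402325015095362453504; -497965808114625645903872;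
   327122635719167101108224; -152466410295440986603520;
   92693098319944072822784; -59869938755058393939968; 20757833484706233974784;
   -12343901090719824084992; 6346315248454376357888; -1858260493112755355648;
   772555317398017671168; -363601900434779799552; 76893182405212372992;
   -4055812521842442240; 4482233917419552768; 2712424816979214336];
  [:: 0; 3894; 5088; -2952202; -21493444; -8894730; 109924028; -16858391574;
   -249643012616; 166590112348; -11221983587612; -67493696892552;
   112381263957272; 640022439102672; -1037856646695104; 2544411331970720;
   32908824864734976; -30480906496562720; -194917031716995008;
   263586549596504736; -83380102674750848; -2968081628303700288;
   5984814180489221440; 9604162452627394176; -28277549799052021888;
   73843860460998119424; -145484999332596593664; -349137120592546275840;
   1572002628165691289088; -2036697034475149292544; 1426716561222798085120;
   6530616572888206913536; -34073515343461439188992; 55046219230398926299136;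
   -9539473309341141942272; -131622418645637272756224;
   390879255334145137426432; -679017886753444381310976;
   525328706759136035520512; 396855177895870589272064;
   -1511196425550423540400128; 2435840161049590908059648;
   -3638981869139323745992704; 4765073426062706991824896;
   -5427981826975858354159616; 7038091364036543666978816;
   -9646201475298839199744000; 10956877614472961111097344;
   -11301333416910932225818624; 11874547299434467663282176;
   -10765037711707137929904128; 8404258389153029166202880;
   -7135615797980011484413952; 5559750983471411155173376;
   -3247636871150056373223424; 2131350628131934692179968;
   -1603795436550600957886464; 731682665579245413072896;
   -307667368756588675334144; 257503664697198703017984;
   -83049172693272458428416; 11730160172817134387200;
   -29793569415185997758464; -4369506965107303776256; -675111228304108027904;
   865681544065302134784; 313551188856951275520; -349506927726296039424;
   -85907435027045548032; 490544913709006848; 605967246346420224];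
  [:: -715; -3484; 321019; 13098250; -13117269; 369833110; -2276782919;
   124256434496; -38891390500; 3300118366106; 29139340064464; 60483039127632;
   -263379720153928; -77262218572360; 1374094230341472; -9479774033819584;
   -28807905689452080; 97594184531451744; 108494532906094864;
   -515575969495874048; 963628542832812864; 1988297007370498848;
   -10549576292464422016; -470841965507322368; 36704527891917524736;
   -98293520754088590976; 268626952725686690048; 166999739960613705472;
   -2470954337999645232640; 5070878614428310595584; -6026500107512587220992;
   -2171730245425659837440; 49795269433012407052288;
   -133373984604874439344128; 149827025784896357142528;
   13043362727733357568000; -491229389063207886389248;
   1373761618718639884836864; -1984749677514844685303808;
   1182273031333512544354304; 1008909636476095274942464;
   -4026448968703131382349824; 7875909941584904219459584;
   -11161219278015731023282176; 12005072717889836366299136;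
   -11724700326071740209561600; 11387025682091803805220864;
   -9383984870990927437234176; 7020955089236154260127744;
   -6113341412821628861022208; 4683644415069739269750784;
   -2933540321962740504592384; 2681973989881209008685056;
   -2471713700305531144503296; 1500559101504691957137408;
   -1155043397253414118227968; 1140993011285538151333888;
   -676504766569095425425408; 385866425166801556996096;
   -335847744319056877977600; 189556752001441223147520;
   -80063989373441660682240; 56925790136137513172992;
   -27498116572378390593536; 10517526073107606929408; -4543245968003058106368;
   1817061075263529418752; -546796290325352546304; 129523628637268475904;
   -16392375866442645504; -18164589598812930048];
  [:: 3432; -32460; -1762636; -10979856; 2882568; -224107088; -7100318704;
   -146700255592; 33967591800; -6897334042924; -34281489512456;
   27586708023512; 238447192487232; -704885201780560; 554513036074624;
   14215935222297280; -10420639319352192; -97009413510652736;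
   127178817103034240; 179654647543453952; -1502744864020516480;
   2160977716265592128; 6109598535800759168; -13090697601942836864;
   9840041605012620800; -13991793533060325632; -174366778265960602624;
   465104337729179353600; 381795858428654339072; -2479288408289514487808;
   5573381179651207942144; -9493814367602524033024; -8136556249289610162176;
   83094388684526593171456; -192112111460501278703616;
   255985973540299210776576; -142592013837946404634624;
   -394996836927895761698816; 1353490986004800540999680;
   -2070356876147188439973888; 2031096753870186807820288;
   -1714623764200969988669440; 1612569532056314413580288;
   -1861332762423943425949696; 3296685836451286947201024;
   -6076884145287603383959552; 8385581174482684832907264;
   -9245693221019652870111232; 9515649785556562078597120;
   -8894806049838909479714816; 6843809912002062267187200;
   -5023379288026669645824000; 3907085603717434581188608;
   -2234709745107435354324992; 892874948299092932952064;
   -690854702415094845800448; 397222352758815363956736;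
   73021464774151772307456; -30698182021331449544704;
   -42549884649854369529856; -55745372902650076463104;
   25856344569504631619584; 7138223519936473464832; 13375731516396728745984;
   -618755964331611914240; -344230398362633895936; -575071946521995902976;
   185198160771752656896; 155401921225581133824; -129850124217090048;
   -3722370227556581376];
  [:: -6006; 74196; 3377666; -7087972; 70103662; -545982116; 24112737386;
   12141883488; 571583886352; 6843293268376; 14464963205728; -69084006211136;
   -65326870066000; 507714145808048; -2055271772050688; -8081746445228160;
   26618166466226528; 43674015364345344; -168028708339219296;
   154375025208472192; 881632504189786112; -3296104072327248512;
   -739679818479263488; 12501397918618744320; -21276508394974633472;
   34352408934053768960; 140654681681203539456; -793947751638170607616;
   1112576428973771786240; 347836831261477983232; -5423570334206782640128;
   19177252546076160557056; -32145815178203147882496; -4014565854338686296064;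
   137304991362078588739584; -370058256493007165923328;
   638478758871162392477696; -638412133663476339507200;
   -143288822246222777876480; 1767118523980160149848064;
   -3803149038208218361626624; 6161733316032642627469312;
   -8541145298723621342937088; 9893792235142456567529472;
   -10234002315631898360545280; 10483623668535370840276992;
   -10011109430348983439458304; 8471644646480164134846464;
   -7480496153948305071538176; 6896863277478849103790080;
   -5572055360560025544163328; 4755760645580894135910400;
   -4677025626626405439635456; 3828808486818517738323968;
   -2835072979241554109530112; 2526733042682694033473536;
   -1961963015331848560574464; 1168353572482329820004352;
   -836222020642096357048320; 600136378291634701336576;
   -297257953605561498992640; 160117295004258368749568;
   -99564714820281009438720; 42001376661166440316928;
   -18331795261972436484096; 7615015331589204738048; -2667585323774358061056;
   838623133827147497472; -219210877876863762432; -2649904386800615424;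
   23344166775916855296];
  [:: 4576; -56546; -2773816; 11581150; -62566192; 633231670; -21507425400;
   49088640586; -564352823996; -4611821159404; 2686297889532; 45672439145904;
   -79939980450136; -90575420671216; 2050857312354464; -207272883590304;
   -16902014569231872; 12056988707961632; 57628049285800448;
   -224193295576304352; 77070390356225600; 1474493422161216320;
   -2177283127982833984; 78892248062026240; 436840308296474752;
   -16240426085748222976; 13398091297779725312; 194988345506122912256;
   -496126619092212113920; 331227053966720427008; 994964677724686928896;
   -6414830689811953563648; 17281147762593901563904; -17994544956228057645056;
   -21442657642700684394496; 121715167851395801219072;
   -280961934994248001486848; 409230220536362386669568;
   -269159877717277762568192; -308464641611252980088832;
   1210695024926415182266368; -2283947466877118182981632;
   3476896938472050694553600; -4591370073524100927324160;
   5500045914797900902039552; -6446859172205366866608128;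
   7434773317399078197526528; -8073021756639982270808064;
   8291641566395593157246976; -8156533477545698243117056;
   7480245574947409961680896; -6345841492327862592602112;
   5164501806381674614751232; -4029787134905838458634240;
   2873704821792687867822080; -1918831304394365305094144;
   1277695846290789744246784; -792845859052098320072704;
   431025085271274998988800; -240591553015757854998528;
   135094866637745658265600; -56437292645098129981440;
   24661471911833411518464; -14177862629505886060544; 3358093090642905268224;
   -1154627930435358818304; 592000233701665406976; -110518575648718454784;
   -36254457486913830912; -125040860357197824; -1240790075852193792];
  [:: -1287; 14400; 835011; -3336390; 11097015; -173478626; 6124557661;
   -14355990832; 121629181980; 1575601924790; -2586544390816; -17606866822800;
   54871586141496; 36153122674744; -897236926440736; 1079288229359360;
   6831532790880080; -16245645951768160; -12694495702105520;
   124638291037131648; -202985966882267328; -401590621040400416;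
   1832961472475370624; -2440258115633270784; -85298201533958912;
   21604714948984826240; -80001427191518127872; 81705807918214045952;
   163738815642301470208; -769409434050063571968; 1803286609317367121920;
   -1979321442269359186944; -3203968727106535700480; 16332936168927196372992;
   -30780680084187095068672; 32713804565467308523520; 5123009784236237815808;
   -121533951870494656995328; 300711626213452310478848;
   -443188026685358653767680; 462237102648748679626752;
   -249194358485728926400512; -446822387282067159842816;
   1727864327091068785065984; -3286888626564205410123776;
   4801728001694599957446656; -6049847835322862632697856;
   6553727406374156240158720; -6069757590035655150796800;
   5026465459711780154507264; -3708053772993281795293184;
   2160095896053055234244608; -865019061698810777436160;
   99957604355073216872448; 423615701186239593971712;
   -712608372938692097998848; 648010049432497554456576;
   -502443916664185586450432; 414428555844077100204032;
   -276923983527722627366912; 149390749492653447970816;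
   -91365692367691260624896; 50940723283753539993600;
   -21399406001758876467200; 10015042107715469967360; -3974001414416577331200;
   1305722517607906541568; -406597253704867381248; 92414992452572676096;
   10385605305437257728; -9161647653094686720];
  [:: 0; 0; -2860; 34860; 1800700; -8935900; 45273100; -498808780;
   14465328260; -49416800380; 417106784840; 2742461447360; -5710109908960;
   -15978166723440; 93091238896800; -144677245834880; -1167192139488000;
   2665618908677440; 4162171065704000; -20665086049913280; 31650490157460800;
   80010421116859200; -367844081403550080; 206479551212085760;
   1178311054189301760; -6214465811306645760; 17164897626525040640;
   -8382549476274065920; -74697852109593712640; 249871363503863951360;
   -479410787327491287040; 377722125177975756800; 1265517637857223249920;
   -5237779793719896965120; 9754929667350060154880; -10127753612179186892800;
   -3091053519904980090880; 42484876741166934671360;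
   -104104766056488788787200; 153612968623638567321600;
   -146065939639210024632320; 29961383649891367976960;
   253071080569853804544000; -685081409296603059978240;
   1130602197094992306503680; -1456155188795680182763520;
   1579354962177885184983040; -1415180197179571712819200;
   987757900663811929538560; -472846654163957705605120;
   -19940987902212513464320; 448410749149987062415360;
   -705504378338186100736000; 770371720900105197322240;
   -740398985502599560560640; 641034418861387399823360;
   -480035764866086076416000; 334940319289048962170880;
   -230016500649027310714880; 139974143884113477632000;
   -75821056195416314347520; 41957780192597251194880;
   -21500256954414866104320; 9264789315648781025280; -3895309791903015239680;
   1486733553658012631040; -491787529523916963840; 135547320682225336320;
   -21804667978100244480; -4352383793202462720; 2741280400138567680]].

Definition cofactor_dH : seq (seq Z) := [::
  [:: 0; 0; 0; 0; -9504; 500416; -7960736; 54916032; -454418848; 7514098368;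
   -81000133728; 513136098816; -625743850048; -4607045121408; 54540700359936;
   258970300983552; 77792454653440; 1262661205616128; 6197928451621376;
   -8236587338323968; -44518838016846336; -2552430911865856;
   -115979818564343296; -410057021948911616; 1541811329774767104;
   1229611884322633728; 298920326386401280; 13519453912682156032;
   -55982567512274685952; -14122049891468484608; 135113757795930234880;
   -226010563519518326784; 1024459065269394112512; -605202742635546935296;
   -3462553144512708149248; 5964303498591848628224; -8818868428602814365696;
   8914702082966030909440; 21797482386824680833024; -65684208958326358147072;
   71831169924459567251456; -63220158802072904925184; 40617580379761842061312;
   89720704464785098407936; -270484700159699166691328;
   392921118203192916574208; -591195833154555919466496;
   812809591271268456333312; -864654621835270786383872;
   890367315318184366571520; -908170848130332067102720;
   772907274228771932078080; -612297265418098238816256;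
   513573953697350479249408; -375396406428963115630592;
   230184523696251961606144; -161731451747449821986816;
   105645382602043034697728; -51242270990009829949440;
   29641373691273128443904; -17366805169319459160064; 5554696180158523506688;
   -3827640338601058762752; 1141732509794493792256; -356587628677545590784;
   154823899166766268416; -53818868768100581376; -9051390826084564992;
   1096512160055427072; -346266997912240128];
  [:: 0; 0; 0; 2288; -326560; 8893488; -43752096; 413498032; -6054405536;
   88669913040; -381135004160; 1369167878240; 11676494746944; -20147371060992;
   -176072750981888; 166940206063488; -453483055200256; -6210360821236480;
   2979521949459968; 39456204620437760; -26272370398789120; 2819318221985024;
   504876632378654720; -1002153193661035008; -1393634051367756800;
   1986267293361219584; -9960347792090136576; 32634884305042702336;
   36335720076480413696; -168586374842409037824; 136818927333623955456;
   -317196005404654084096; -418478869626400948224; 4189757494438937509888;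
   -5611519822173546643456; -315190616010732961792; 10137411013596092825600;
   -35517118433848643813376; 67757440997017189482496;
   -35505196012615830077440; -46857674317159146455040;
   68959969065414579978240; -99797610347988169261056;
   223126875416802747744256; -302212061972266326425600;
   435109803407947880988672; -854206115117574918242304;
   1253600884471816062500864; -1422432870949877167685632;
   1651592443018483381305344; -1744234185479935217369088;
   1478407018262612458602496; -1273851865468506680066048;
   1108385666203811930177536; -752342912373864676720640;
   484439497414757066997760; -367870169003128677990400;
   215184734042392511905792; -100325010777449609297920;
   68870854640896386793472; -33029362786646183903232; 9302944490846452449280;
   -9130154107550480465920; 1096541974687603752960; -593293283015429980160;
   333583751954332385280; -45249492844516737024; -59131858487095590912;
   -6377440119984488448; -1962179654836027392; -346266997912240128];
  [:: 0; 0; 1672; 75608; -3814216; 3465192; -114525384; 1660958856;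
   -32616418328; -5824699096; -211520873392; -8971570510880; -18398648069952;
   113103620367552; 146419084438720; -457763288926336; 3456123343899392;
   10002564837843712; -33581789673301632; -49891481165728640;
   121946872175828352; -316058839409452928; -461898632713646848;
   3585961951057262592; 18266798339749888; -5011841382383890432;
   22474078852590291968; -119927262585383349248; 38587624770066972672;
   479481062184649592832; -947321647825973895168; 2256961173060264452096;
   -2517103279132099067904; -7965019377759561498624; 24559914060535662526464;
   -31288350355000140955648; 23875862958777226559488; 52540353840625130766336;
   -227599486871014524846080; 325057321708792979914752;
   -213982136759233342472192; -20524116505687265378304;
   462222182645288411332608; -1158587852357956923031552;
   1656977690022994725306368; -1855267366218572651036672;
   2120542202997399777968128; -2121285434212640469549056;
   1729705579314181285347328; -1503739673542806617456640;
   1267796204006254655307776; -798630155904811783946240;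
   535849719214750268653568; -461602465230934824189952;
   257974628701503383142400; -111086876125922095792128;
   121540917640702088708096; -72862014930462745559040;
   18672254430175154929664; -24673398478793936470016; 17801745216234185555968;
   -2757671516548800446464; 4391079502713079201792; -2191028613322830249984;
   703589465395000508416; -351367548790609281024; 170386182237145006080;
   -44882722153769730048; 14020963481306529792; -5001634414287912960;
   -2366157819066974208];
  [:: 0; -1122; -548; 823094; 6166896; 2518966; 8215408; 4297775674;
   69184853860; -3732510324; 3134519826004; 19256926399416; -16760633690136;
   -151137616398608; 258325470028096; -483381633530208; -8381775033616320;
   4425804132703328; 49649777845045632; -52503705115437664; -8685713635772864;
   752247574312113088; -1190671217637042624; -2866609575740584320;
   6102595024795299456; -15376639377546634752; 29049431607049790976;
   93791331021913959936; -334349915103564982784; 313599257321236206592;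
   -87443522534842031104; -1704001625773083107328; 7189091452724075450368;
   -8780774692785160052736; -5562469920912970301440; 36614265056227995852800;
   -84145068313740212338688; 121445218655275134894080;
   -47690742178394636107776; -168345254448244552663040;
   359188746650813685989376; -469533939900695495442432;
   653451546177139503661056; -855616529108732133113856;
   1050068008346804083359744; -1580663885274385794465792;
   2359600911083626119823360; -2803106896969781716451328;
   3007715493149600869515264; -3201479928103967333023744;
   2914727115234647721639936; -2319356698816119272636416;
   1976420326444277174370304; -1523501078884050213535744;
   903933786532968744878080; -607603034910057260122112;
   447818025528782175076352; -203009130317133536821248;
   92831309009351172161536; -76012416277516312903680; 23246686867886618705920;
   -4807315894122416439296; 9236164138913419493376; 950124141806981480448;
   342590272260643225600; -324883578402386214912; -61259928058283950080;
   87248685281304379392; 26773439089345560576; 500163441428791296;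
   -317411414752886784];
  [:: 143; 1172; -76183; -2664982; 1701493; -65627698; 315214175;
   -23763122036; -7039727720; -651592040646; -6191002673300; -13732033653360;
   48129861368080; 21620565941848; -294069661319520; 1888737636603040;
   6118378609401328; -18274203728438944; -24392166758568528;
   99430418227335616; -178861521078422784; -434840413844665952;
   2051204235955964992; 291132004648884736; -6717704418146892160;
   17806494945299084160; -50577662146774176512; -39315050654866163968;
   474697874404720643072; -901922890069405081600; 983632069835819015168;
   688328107900141440000; -9740161093588749834240; 24347350249135513051136;
   -24033595108071618154496; -10412870424280510242816;
   102137677631549958619136; -264761578139616942678016;
   362372267366351315845120; -181964796095536919773184;
   -254358004410877517266944; 853559001215356619161600;
   -1643129887036180031143936; 2324527850583846713229312;
   -2510093016941434865713152; 2476094585247635018088448;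
   -2389678227945859449618432; 1895480904240922627932160;
   -1335002143931306048225280; 1105950851579325604429824;
   -759188140103597845118976; 380639928904265284714496;
   -376120322421253059117056; 365627728908613844992000;
   -185066032543518209081344; 172007890609963783946240;
   -207185590359122279137280; 112416931098888025145344;
   -69005883340234445291520; 72785054223804697411584;
   -39078660718701664272384; 16684827317052498771968;
   -13613786461382398443520; 6416567744772328914944; -2593997499546757758976;
   1160444341723613626368; -464399100870685360128; 150047696522009640960;
   -41391107531046125568; 4782812908662816768; 5150721593944571904];
  [:: -572; 4816; 311614; 1828086; -139362; 26220178; 1352870334; 23054720442;
   6974888150; 1138531916602; 5873715290996; -3723071149144; -38956731749264;
   110392567575928; -75915980825744; -2384022437163776; 1430086921792064;
   16156907581122336; -19559667119746144; -30820797492082656;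
   246820629498432736; -328308464855742432; -1063313051155807680;
   2148948020989986176; -1734547599723851776; 2335043738397470336;
   30628242078368887808; -80432369383363097856; -54974071273816670208;
   383535951003881589760; -893427418210660596736; 1596724215811701580800;
   1150376481975818831872; -12877257126935241728000; 29466080660644875632640;
   -38992693797547794669568; 21756648163550096482304; 60836580484538967728128;
   -206323480689901816004608; 311096398894449874337792;
   -304988826071262702665728; 267054050118375736115200;
   -257058402523167745114112; 285047736780287494389760;
   -483709385583269005492224; 868256658196611962765312;
   -1163741494874968673222656; 1257234656091672671944704;
   -1288359648461678393688064; 1193052388703597367394304;
   -900426994060006900367360; 664971763084115438469120;
   -528870633774188119195648; 298799825790763188355072;
   -121135740784255908708352; 105901893789275016658944;
   -63383962887020773113856; -6004413074071114219520; -2746305486328959074304;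
   11355674816218753138688; 6245560929485202653184; -1947917822824187691008;
   -2315384632219738832896; -1693020032096830226432; -137094171364541071360;
   158897786010501906432; 60986841530659504128; -21023073540425908224;
   -26588371491181559808; -343862365982294016; 764672953722863616];
  [:: 858; -10260; -493054; 1013660; -9922538; 84575388; -3526789366;
   -1086472728; -86085832944; -982449116616; -2052202013864; 9444631995608;
   9241074159088; -68394691867856; 287710564021120; 1132122235812096;
   -3605067655174240; -6356396908077376; 22836793311141024;
   -20008294578733184; -123122431191579392; 447989505082508160;
   136507846434377344; -1696135072552252032; 2665868539375350272;
   -4096983195782529280; -21503904010469581312; 113542449611562809344;
   -152437958012254363648; -66866186804691448832; 805348311557482016768;
   -2776183456214900529152; 4600003156530870501376; 547149200478526709760;
   -19321562067560180318208; 52274146112440551129088;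
   -91223073434193777541120; 93750281921206018211840; 13407749038575351627776;
   -242576695326506273374208; 540636949730143991037952;
   -897288282313719480778752; 1254967050911533219184640;
   -1443193313317794920267776; 1453834902500129621934080;
   -1418930633736322613510144; 1262792697304896519012352;
   -969487188183977079341056; 793619385978617798328320;
   -710817727409292453085184; 550692488287286265380864;
   -488198551765519282733056; 536255888655501009879040;
   -463353155397983607455744; 361865913062738324619264;
   -347708876821246557290496; 279248744563220097794048;
   -170448887961477535760384; 127163193262461161570304;
   -92550684669450567811072; 46201695698976849788928;
   -25561047483669953904640; 16003580669043398410240; -6768175355915225006080;
   2993772784703699419136; -1252149591723875500032; 440218446264199544832;
   -139262298893108379648; 36255971514425278464; 524209760728252416;
   -3837792560193994752];
  [:: -572; 6994; 348992; -1444846; 7752704; -80743678; 2701687368;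
   -6241536418; 70958548576; 580094156676; -355597084660; -5638258323520;
   10141645214840; 9815788150848; -256018569479072; 41325388719264;
   2061617394385536; -1547256424985696; -6601423620288512; 27282759331280608;
   -12221263219163392; -174474790193275840; 268237711607272896;
   -74048303890203392; 130014569931228544; 1909854000693316864;
   -2277223299201954304; -21595559071334739456; 55887002458786180608;
   -37463797533344618496; -106278830094494280704; 730393133169464801280;
   -2017583566515291385856; 2125196130914899116032; 2460324126995537879040;
   -14224697339625652445184; 33392499304061347725312;
   -49736258817866971136000; 34631552446728155217920; 33279717751644307259392;
   -142992622144145879302144; 279570180526809948291072;
   -436417309753320988213248; 583582836599580575268864;
   -700146598191160785502208; 812091744869146904494080;
   -916482753916165731123200; 969781150366213916327936;
   -973358274279549424369664; 938581000007006151507968;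
   -843585515588588576702464; 703486575749444403200000;
   -566374292913727947669504; 437045746140905962733568;
   -307746401377150033723392; 204553446167054492106752;
   -135891127308950723100672; 83454499981933271842816;
   -45207819023674345783296; 25461354928642675703808;
   -14237127640513257668608; 5881207134459776729088; -2612556997266585419776;
   1529644215120825417728; -353856810955179032576; 124749056293377933312;
   -66414395138588540928; 12952772541759356928; 3646401670658654208;
   100994541057736704; 173133498956120064];
  [:: 143; -1600; -92779; 370578; -1228843; 19275294; -680597257; 1592325588;
   -13488172048; -175297691994; 288622600524; 1959388795992; -6119440163648;
   -3877828761288; 99819694739744; -121602567161888; -757091701930256;
   1818935965905632; 1338774387346352; -13829268387443392; 23071651720308352;
   43517611716862560; -204543437217646016; 280502236768412288;
   -4009778167176320; -2438592530999415424; 9092830139225182464;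
   -9520797049644569344; -17895830495985900544; 87260130992994968576;
   -208007061201327066112; 235522067299438644224; 340946746701796136960;
   -1834892048482338177024; 3544011020808613122048; -3910718455717332393984;
   -248369607499021238272; 13503209460497801797632; -34279453129018743111680;
   51310462290382878605312; -54020692062627453108224; 29049613425259478745088;
   51784179359717924339712; -198460526533974081863680;
   374596152369293756989440; -541965926877265743839232;
   674234825248060872065024; -719333421646898354454528;
   653384108819124910030848; -526782011101117460512768;
   373042127253189049712640; -198691218894835071057920;
   56881559216837730762752; 23268808270055907262464; -74831368053839542353920;
   99777663791793856053248; -86387247479792785686528; 65357679425321223323648;
   -51898138534941504307200; 34127117289091386834944;
   -18428404170196472823808; 11070280086734459895808; -6098784217256962293760;
   2573399463872683835392; -1184638266885690884096; 467823180465573986304;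
   -154048368260841209856; 47216640092887056384; -10347843678092918784;
   -1228766916202463232; 1053228785316397056];
  [:: 0; 0; 286; -3486; -180070; 893590; -4527310; 49880878; -1446532826;
   4941680038; -41710678484; -274246144736; 571010990896; 1597816672344;
   -9309123889680; 14467724583488; 116719213948800; -266561890867744;
   -416217106570400; 2066508604991328; -3165049015746080; -8001042111685920;
   36784408140355008; -20647955121208576; -117831105418930176;
   621446581130664576; -1716489762652504064; 838254947627406592;
   7469785210959371264; -24987136350386395136; 47941078732749128704;
   -37772212517797575680; -126551763785722324992; 523777979371989696512;
   -975492966735006015488; 1012775361217918689280; 309105351990498009088;
   -4248487674116693467136; 10410476605648878878720; -15361296862363856732160;
   14606593963921002463232; -2996138364989136797696; -25307108056985380454400;
   68508140929660305997824; -113060219709499230650368;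
   145615518879568018276352; -157935496217788518498304;
   141518019717957171281920; -98775790066381192953856;
   47284665416395770560512; 1994098790221251346432; -44841074914998706241536;
   70550437833818610073600; -77037172090010519732224; 74039898550259956056064;
   -64103441886138739982336; 48003576486608607641600;
   -33494031928904896217088; 23001650064902731071488;
   -13997414388411347763200; 7582105619541631434752; -4195778019259725119488;
   2150025695441486610432; -926478931564878102528; 389530979190301523968;
   -148673355365801263104; 49178752952391696384; -13554732068222533632;
   2180466797810024448; 435238379320246272; -274128040013856768]].

Definition P5_shift : seq Z := comp1 P5_coeffs [:: 4; 4].

Close Scope Z_scope.

Section Curve.
Variable R : realType.
Implicit Types (u v : R).

(* Notation for a matrix of the family, with [u = A2_22 - 1], [x = A_21] and
   [v] defined by [A4_44 = 2 + 2 v]: [Wf u = (2 - u) (1 + u)],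
   [Bf u v = u (1 + x)], [Tf u v = (A2_42 / A2_22) (Wf u - 2)] and
   [Yf u v = A_41 u (Wf u - 2)]; [Hf u v = 0] is the one equation left after
   solving the others for the entries. *)
Definition Wf u : R := 2 + u - u * u.
Definition Bf u v : R := Wf u * (1 - v) - 2.
Definition Tf u v : R := (Wf u - 2) * (1 - 2 * v) + 4 * (v * v) * Wf u.
Definition Yf u v : R :=
  - 2 * v * Bf u v * (Wf u - 4 - 2 * v * Wf u) - u * Tf u v.
Definition Zf u v : R := Bf u v - v * (Wf u - 2) * (2 + Wf u * v).
Definition Hf u v : R :=
  Tf u v * Yf u v * Zf u v +
  Bf u v * (Wf u - 2) *
    (u * (u * u) * Tf u v + (u - 1 - Wf u * v) * Yf u v).

Lemma den_H u v : den H_exp u v = Hf u v.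
Proof. rewrite /Hf /Zf /Yf /Tf /Bf /Wf /=; ring. Qed.

Lemma ev_H u v : ev2 Hpoly u v = Hf u v.
Proof. by rewrite -den_H -norm_den; congr ev2; vm_compute. Qed.

Lemma P5_ev (g : R) : P5 g = ev1 P5_coeffs g.
Proof.
have E (p : seq Z) n (x : R) : size p = n ->
    \sum_(k < n) zR R (nth Z0 p k) * x ^+ k = ev1 p x.
  elim: p n => [|c p IH] [|n] //=; first by rewrite big_ord0.
  move=> [sp]; rewrite big_ord_recl /= expr0 mulr1; congr (_ + _).
  rewrite -(IH _ sp) big_distrr; apply: eq_bigr => i _ /=.
  by rewrite exprS; ring.
by rewrite /P5; exact: E.
Qed.

Lemma P5_shiftE v : ev1 P5_shift v = P5 (4 + 4 * v).
Proof.
by rewrite P5_ev ev1_comp; congr (ev1 P5_coeffs _); rewrite /=; ring.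
Qed.

(** The divided difference of P5(4 + 4v) is positive on the square [0, 1/4]^2. In the bisection,
    [eU] and [eV] are the negated upper bounds 1/4. *)
Lemma P5_shift_inj (v w : R) : 0 <= v <= 1 / 4 -> 0 <= w <= 1 / 4 ->
  P5 (4 + 4 * v) = P5 (4 + 4 * w) -> v = w.
Proof.
move=> hv hw /eqP; rewrite -subr_eq0 -!P5_shiftE ev2_tails mulf_eq0 subr_eq0.
case/orP => [/eqP//|/eqP E].
have hv' : 0 <= v <= 1 by move: hv => /andP[? ?]; apply/andP; split; lra.
have hw' : 0 <= w <= 1 by move: hw => /andP[? ?]; apply/andP; split; lra.
pose eU := PSub (PMul (PC (Zpos 4)) PU) (PC (Zpos 1)).
pose eV := PSub (PMul (PC (Zpos 4)) PV) (PC (Zpos 1)).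
have : bisect_pos (flatten (nseq 8 [:: true; false]))
  [:: tails P5_shift; norm eU; norm eV] by vm_compute.
move/(bisect_pos_sound hw' hv'); move: (tails P5_shift) E => t E.
change (is_true [|| 0 < ev2 t w v, 0 < ev2 (norm eU) w v
                  | (0 < ev2 (norm eV) w v) || false] -> v = w).
rewrite E ltxx !norm_den orbF /=.
by move: hv hw => /andP[? ?] /andP[? ?] /orP[] ?; lra.
Qed.

Lemma ev2_zero p u v : all zero1 p -> ev2 p u v = 0.
Proof.
have zero1E r : zero1 r -> ev1 r v = 0.
  by elim: r => [//|[|?|?] r IH] //= /IH ->; ring.
by elim: p => [//|r p IH] /= /andP[/zero1E -> /IH ->]; ring.
Qed.

Lemma critical_P5_eq0 u v : Hf u v = 0 -> ev2 (deriv2 Hpoly) u v = 0 ->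
  v ^+ 8 * (1 + 2 * v) ^+ 2 * P5 (4 + 4 * v) = 0.
Proof.
move=> H0 dH0.
pose E := mul1 (iter 8 (cons Z0) [:: Zpos 1; Zpos 4; Zpos 4]) P5_shift.
(* The cofactors were divided by their content, whereas P5(4 + 4v), expanded in v, has all
   coefficients divisible by 2^75; this power restores the balance. *)
pose lhs := map (map (Z.mul (Z.pow 2 75)))
  (add2 (mul2 cofactor_H Hpoly) (mul2 cofactor_dH (deriv2 Hpoly))).
have : all zero1 (add2 lhs (map (map Z.opp) [:: E])) by vm_compute.
move=> /(@ev2_zero _ u v); rewrite ev2_add ev2_opp /lhs.
rewrite ev2_zscale ev2_add !ev2_mul ev_H H0 dH0 !mulr0 addr0 mulr0 add0r.
move/eqP; rewrite oppr_eq0 => /eqP <-.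
have -> (e : seq Z) : ev2 [:: e] u v = ev1 e v by rewrite /= mulr0 addr0.
rewrite ev1_mul P5_shiftE; congr (_ * _); rewrite /=; ring.
Qed.

End Curve.

(** Positive exactly when e > n/d ([b] true) or e < n/d ([b] false): the negation of a hypothesis e
    <= n/d or e >= n/d, as the bisection expects. *)
Definition bound_exp (b : bool) (n d : positive) (e : pexp) : pexp :=
  if b then PSub (PMul (PC (Zpos d)) e) (PC (Zpos n))
  else PSub (PC (Zpos n)) (PMul (PC (Zpos d)) e).

(** * Location of the zeros of H, and estimates near the maximizer *)

Section Region.
Variable R : realType.
Implicit Types (u v : R).

Lemma Hf_gt0 u v : 0 <= u <= 1 -> 83 / 2500 <= v <= 1 / 9 -> 0 < Hf u v.
Proof.
move=> hu /andP[v0 v1].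
have hv : 0 <= v <= 1 by apply/andP; split; lra.
(* Splitting v first disposes cheaply of the cells outside the range of v. *)
have : bisect_pos (nseq 6 false ++ flatten (nseq 12 [:: true; false]))
  (map norm [:: H_exp; bound_exp false 83 2500 PV; bound_exp true 1 9 PV])
  by vm_compute.
move=> /(bisect_pos_den)/(_ hu hv); rewrite /has den_H /=.
by move=> /or4P[] //; lra.
Qed.

(** Bisection makes H positive on the part of the strip with u >= 49/100 and on the part with u <=
    42/100; heights from 83/2500 on are excluded by [Hf_gt0]. *)
Lemma Hf0_near u v : 0 <= u <= 1 -> 33 / 1000 <= v <= 1 / 9 -> Hf u v = 0 ->
  42 / 100 < u < 49 / 100 /\ v < 83 / 2500.
Proof.
move=> hu /andP[v0 v1] H0.
have hv : 0 <= v <= 1 by apply/andP; split; lra.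
have : bisect_pos (nseq 6 false ++ flatten (nseq 12 [:: true; false]))
  (map norm [:: H_exp; bound_exp false 33 1000 PV; bound_exp true 1 9 PV;
                bound_exp false 49 100 PU])
  by vm_compute.
move=> /(bisect_pos_den)/(_ hu hv); rewrite /has den_H H0 ltxx /= => h1.
have : bisect_pos (nseq 6 false ++ flatten (nseq 12 [:: true; false]))
  (map norm [:: H_exp; bound_exp false 33 1000 PV; bound_exp true 1 9 PV;
                bound_exp true 42 100 PU])
  by vm_compute.
move=> /(bisect_pos_den)/(_ hu hv); rewrite /has den_H H0 ltxx /= => h2.
split.
  by apply/andP; split; [case/or4P: h2|case/or4P: h1] => // ?; lra.
rewrite ltNge; apply/negP => hv2.
by have := @Hf_gt0 u v hu; rewrite hv2 v1 H0 ltxx => /(_ isT).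
Qed.

Lemma Hf_lt0 : Hf (9 / 20 : R) (33 / 1000) < 0.
Proof. rewrite /Hf /Zf /Yf /Tf /Bf /Wf; lra. Qed.

Definition box_exps : seq pexp :=
  [:: bound_exp false 33 1000 PV; bound_exp true 83 2500 PV;
      bound_exp false 42 100 PU; bound_exp true 49 100 PU].

(** The schedule follows the shape of the box: 2^-13 and 2^-4 are just below its sides 1/5000 in v
    and 7/100 in u. *)
Lemma box_pos e u v :
  bisect_pos (nseq 13 false ++ nseq 4 true ++ flatten (nseq 8 [:: true; false]))
    (map norm (e :: box_exps)) ->
  42 / 100 <= u <= 49 / 100 -> 33 / 1000 <= v <= 83 / 2500 ->
  0 < den e u v.
Proof.
move=> + /andP[u0 u1] /andP[v0 v1].
have hu : 0 <= u <= 1 by apply/andP; split; lra.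
have hv : 0 <= v <= 1 by apply/andP; split; lra.
move=> /bisect_pos_den/(_ hu hv); rewrite [has _ _]/= => {hu hv}.
by case/orP => // /or4P[] //; rewrite ?orbF; lra.
Qed.

Section Box.
Variables u v : R.
Hypotheses (hu : 42 / 100 <= u <= 49 / 100)
  (hv : 33 / 1000 <= v <= 83 / 2500).

(** These are the bounds 0.96 < t < 0.98 for the multiplier t = T / (W - 2), with the denominator
    cleared. *)
Lemma Tf_bounds : 96 * (Wf u - 2) < 100 * Tf u v < 98 * (Wf u - 2).
Proof.
pose e1 := PSub (PMul (PC (Zpos 100)) T_exp) (PMul (PC (Zpos 96)) W2_exp).
pose e2 := PSub (PMul (PC (Zpos 98)) W2_exp) (PMul (PC (Zpos 100)) T_exp).
rewrite -subr_gt0 -[X in _ && X]subr_gt0; apply/andP; split.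
  have -> : 100 * Tf u v - 96 * (Wf u - 2) = den e1 u v.
    by rewrite /Tf /Wf /=; ring.
  by apply: box_pos => //; vm_compute.
have -> : 98 * (Wf u - 2) - 100 * Tf u v = den e2 u v.
  by rewrite /Tf /Wf /=; ring.
by apply: box_pos => //; vm_compute.
Qed.

(** These are the bounds -0.81 < y < -0.75 for the entry y = Y / (u (W - 2)), with the denominator
    cleared. *)
Lemma Yf_bounds :
  75 * (u * (Wf u - 2)) < - 100 * Yf u v < 81 * (u * (Wf u - 2)).
Proof.
pose y := PMul (PC (Zneg 100)) Y_exp.
pose e1 := PSub y (PMul (PC (Zpos 75)) (PMul PU W2_exp)).
pose e2 := PSub (PMul (PC (Zpos 81)) (PMul PU W2_exp)) y.
rewrite -subr_gt0 -[X in _ && X]subr_gt0; apply/andP; split.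
  have -> : - 100 * Yf u v - 75 * (u * (Wf u - 2)) = den e1 u v.
    by rewrite /Yf /Bf /Tf /Wf /=; ring.
  by apply: box_pos => //; vm_compute.
have -> : 81 * (u * (Wf u - 2)) - - 100 * Yf u v = den e2 u v.
  by rewrite /Yf /Bf /Tf /Wf /=; ring.
by apply: box_pos => //; vm_compute.
Qed.

(** The left side is t y u (W - 2)^2 (A_23 + 1), where t y < 0, so the claim is A_23 > -1. Separate
    interval bounds on the two terms of A_23 = b + x al are too weak for this, hence a certificate
    of its own. *)
Lemma entry23_gtN1 :
  (u - 1 - Wf u * v) * Yf u v * (Wf u - 2) +
  (Wf u * v + u * u) * u * Tf u v * (Wf u - 2) + Tf u v * Yf u v < 0.
Proof.
pose n := PMul W_exp PV.
pose e := PSub (PSub (PSub (PC Z0)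
  (PMul (PMul (PSub (PSub PU (PC (Zpos 1))) n) Y_exp) W2_exp))
  (PMul (PMul (PMul (PAdd n (PMul PU PU)) PU) T_exp) W2_exp))
  (PMul T_exp Y_exp).
rewrite -oppr_gt0; set x := - _; have -> : x = den e u v.
  by rewrite /x /Yf /Bf /Tf /Wf /=; ring.
by apply: box_pos => //; vm_compute.
Qed.
End Box.
End Region.

(** * Existence of the highest point of the curve, and its equation *)

Section Maximizer.
Import numFieldNormedType.Exports.
Local Open Scope classical_set_scope.
Variable R : realType.
Implicit Types (u v : R).

Lemma ev1_continuous (p : seq Z) : continuous (fun v : R => ev1 p v).
Proof.
elim: p => [|c p IH] x /=; first exact: cvg_cst.
by apply: cvgD; [exact: cvg_cst|apply: cvgM; [exact: cvg_id|exact: IH]].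
Qed.

Lemma ev2_continuous (p : seq (seq Z)) :
  continuous (fun z : R * R => ev2 p z.1 z.2).
Proof.
elim: p => [|r p IH] x /=; first exact: cvg_cst.
apply: cvgD.
  apply: (@continuous_comp _ _ _ snd (fun v : R => ev1 r v)).
    exact: cvg_snd.
  exact: ev1_continuous.
by apply: cvgM; [exact: cvg_fst|exact: IH].
Qed.

Lemma ev2_is_derive (p : seq (seq Z)) u v :
  is_derive u 1 (fun x : R => ev2 p x v) (ev2 (deriv2 p) u v).
Proof.
elim: p => [|r p IH] /=; first exact: is_derive_cst.
apply: is_derive_eq.
by rewrite ev2_add /= !add0r addrC; congr (_ + _); exact: mulr1.
Qed.

Lemma ev2_ivt (p : seq (seq Z)) u a b : a <= b ->
  ev2 p u a <= 0 -> 0 <= ev2 p u b ->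
  exists2 c, a <= c <= b & ev2 p u c = 0.
Proof.
move=> ab ha hb.
have cf : {within `[a, b]%classic, continuous (fun v : R => ev2 p u v)}.
  apply: continuous_subspaceT; elim: p {ha hb} => [|r p IH] v /=.
    exact: cvg_cst.
  apply: cvgD; first exact: ev1_continuous.
  by apply: cvgM; [exact: cvg_cst|exact: IH].
have [|c cab fc] := @IVT R (fun v => ev2 p u v) a b 0 ab cf.
  by rewrite ge_min ha le_max hb orbT.
by exists c.
Qed.

Lemma curve_maximizer : exists u v, [/\
  42 / 100 < u < 49 / 100, 33 / 1000 <= v < 83 / 2500,
  Hf u v = 0, P5 (4 + 4 * v) = 0
  & forall u' v', 0 <= u' <= 1 -> 33 / 1000 <= v' <= 1 / 9 ->
      Hf u' v' = 0 -> v' <= v].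
Proof.
pose K : set (R * R) := (`[0, 1] `*` `[33 / 1000, 1 / 9])
  `&` ((fun z => ev2 Hpoly z.1 z.2) @^-1` [set 0]).
have KE u v : K (u, v) <->
    [/\ 0 <= u <= 1, 33 / 1000 <= v <= 1 / 9 & Hf u v = 0].
  split=> [[[hu hv] Huv]|[hu hv Huv]].
    have {}Huv : ev2 Hpoly u v = 0 := Huv.
    by split; rewrite -?ev_H.
  split; first by split; rewrite /= in_itv.
  by change (ev2 Hpoly u v = 0); rewrite ev_H.
(* On the segment u = 9/20, H changes sign between v = 33/1000 and v = 1/9. *)
have K0 : K !=set0.
  have [|||c hc Hc] := @ev2_ivt Hpoly (9 / 20) (33 / 1000) (1 / 9).
  - lra.
  - by rewrite ev_H ltW ?Hf_lt0.
  - by rewrite ev_H ltW // Hf_gt0 //; apply/andP; split; lra.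
  exists (9 / 20, c); apply/KE; split=> //; last by rewrite -ev_H.
  by apply/andP; split; lra.
have Kc : compact K.
  apply: compact_closedI.
    by apply: compact_setX; exact: segment_compact.
  apply: preimage_closed; last exact: closed_eq.
  by move=> z _; exact: ev2_continuous.
have [|[u v]] := @compact_EVT_max _ R snd K K0 Kc.
  by apply: continuous_subspaceT => z; exact: cvg_snd.
rewrite inE => /KE[hu hv Huv] vmax.
have {}vmax u' v' : 0 <= u' <= 1 -> 33 / 1000 <= v' <= 1 / 9 ->
    Hf u' v' = 0 -> v' <= v.
  by move=> *; apply: (vmax (u', v')); rewrite inE; apply/KE.
have [ubox vbox] := Hf0_near hu hv Huv.
have v0 : 33 / 1000 <= v by case/andP: hv.
exists u, v; split=> //; first by rewrite v0.
(* If H(x, v) were negative, then, H being positive at height 83/2500, there would be a zero above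
   (x, v), against maximality of v. So u minimizes H(., v) on an open interval and dH/du vanishes
   there; no smoothness of the curve is needed. *)
have Hge0 x : x \in `]42 / 100, 49 / 100[%R -> 0 <= ev2 Hpoly x v.
  move=> xab; have /andP[x0 x1] : 42 / 100 < x < 49 / 100.
    by move: xab; rewrite in_itv.
  have x01 : 0 <= x <= 1 by apply/andP; split; lra.
  rewrite leNgt; apply/negP => Hx.
  have [|||c /andP[c0 c1] Hc] := @ev2_ivt Hpoly x v (83 / 2500).
  - exact: ltW.
  - exact: ltW.
  - by rewrite ev_H ltW // Hf_gt0 //; apply/andP; split; lra.
  have : c <= v.
    by apply: (vmax x) => //; rewrite -?ev_H //; apply/andP; split; lra.
  move=> cv; have cE : c = v by apply/eqP; rewrite eq_le cv c0.
  by rewrite cE in Hc; move: Hx; rewrite Hc ltxx.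
have D0 : ev2 (deriv2 Hpoly) u v = 0.
  have h1 : is_derive u 1 (fun x => ev2 Hpoly x v) 0.
    apply: (@derive1_at_min R _ (42 / 100) (49 / 100)) => //.
    - lra.
    - by move=> t ht; rewrite {1}ev_H Huv; exact: Hge0.
  have h2 := ev2_is_derive Hpoly u v.
  by rewrite -(@derive_val _ _ _ _ _ _ _ h2) (@derive_val _ _ _ _ _ _ _ h1).
have /eqP := critical_P5_eq0 Huv D0.
(* The extraneous factors v and 1 + 2v are excluded by v >= 33/1000. *)
rewrite 2!mulf_eq0 !expf_eq0 /= => /orP[/orP[]|/eqP//] /eqP; lra.
Qed.

End Maximizer.

(** * Schur complements and growth *)

Section Schur.
Variables (R : realType) (n : nat).
Implicit Types (A : 'M[R]_n) (m i j : nat) (X : nat -> R).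

Lemma lead0_unit A : lead A 0 \in unitmx.
Proof. by rewrite unitmxE det_mx00 unitr1. Qed.

(** The coefficients expressing row i through the first m rows on the first m columns. They replace
    the inverse matrix, and indexing by [nat] lets m grow without casts. *)
Definition row_sol A m i X :=
  forall q, (q < m)%N -> \sum_(p < m) X p * ent A p q = ent A i q.

Lemma row_sol_ex A m i : lead A m \in unitmx -> exists X, row_sol A m i X.
Proof.
move=> U; pose x := rowpart A m i *m invmx (lead A m).
exists (fun p => oapp (x 0) 0 (insub p)) => q qm.
have E : x *m lead A m = rowpart A m i by rewrite mulmxKV.
move/matrixP/(_ 0 (Ordinal qm)): E; rewrite !mxE /= => <-.
by apply: eq_bigr => p _; rewrite valK /=; congr (_ * _); rewrite mxE.
Qed.

Lemma schurE A m i j X : lead A m \in unitmx -> row_sol A m i X ->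
  schur A m.+1 i.+1 j.+1 = ent A i j - \sum_(p < m) X p * ent A p j.
Proof.
move=> U HX; rewrite /schur /=; congr (_ - _).
have -> : rowpart A m i = (\row_(p < m) X p) *m lead A m.
  apply/rowP => q; rewrite !mxE -HX //.
  by apply: eq_bigr => p _; rewrite !mxE.
by rewrite mulmxK // mxE; apply: eq_bigr => p _; rewrite !mxE.
Qed.

Lemma schur1 A i j : schur A 1 i.+1 j.+1 = ent A i j.
Proof.
have U := lead0_unit A; have [X HX] := row_sol_ex i U.
by rewrite (schurE j U HX) big_ord0 subr0.
Qed.

(** The row (-X, 1) times the larger leading block is (0, ..., 0, pivot), so a zero pivot would give
    a nonzero kernel vector. *)
Lemma pivot_neq0 A m : lead A m \in unitmx -> lead A m.+1 \in unitmx ->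
  schur A m.+1 m.+1 m.+1 != 0.
Proof.
move=> U U'; apply/eqP => s0; have [X HX] := row_sol_ex m U.
move: s0; rewrite (schurE m U HX) => s0.
pose y : 'rV[R]_m.+1 := \row_p (if (p < m)%N then - X p else 1).
have y0 : y *m lead A m.+1 = 0.
  apply/rowP => q; rewrite !mxE big_ord_recr /= !mxE ltnn mul1r.
  under eq_bigr do rewrite !mxE /= ltn_ord mulNr.
  rewrite sumrN; have [qm|mq] := ltnP q m; first by rewrite HX // addNr.
  have -> : q = m :> nat by apply/eqP; rewrite eqn_leq mq -ltnS ltn_ord.
  by rewrite addrC.
have : y = 0 by rewrite -[y](mulmxK U') y0 mul0mx.
move=> /rowP/(_ ord_max); rewrite !mxE ltnn => /eqP.
by rewrite oner_eq0.
Qed.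

(** Let l be the last coordinate of a kernel row y. Adding l X to its other coordinates gives a
    kernel row of the smaller block, hence 0; the last column then reads l * pivot = 0. *)
Lemma lead_unitS A m : lead A m \in unitmx ->
  schur A m.+1 m.+1 m.+1 != 0 -> lead A m.+1 \in unitmx.
Proof.
move=> U; have [X HX] := row_sol_ex m U; rewrite (schurE m U HX) => s0.
rewrite -row_free_unit; apply: inj_row_free => y y0.
pose l := y 0 ord_max.
pose z : 'rV[R]_m := \row_p (y 0 (widen_ord (leqnSn m) p) + l * X p).
have yq q : (q < m.+1)%N -> \sum_(p < m) y 0 (widen_ord (leqnSn m) p)
    * ent A p q + l * ent A m q = 0.
  move=> qm; move/rowP/(_ (Ordinal qm)): y0; rewrite !mxE big_ord_recr /= !mxE.
  by under eq_bigr do rewrite !mxE.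
have z0 : z = 0.
  rewrite -[z](mulmxK U); suff -> : z *m lead A m = 0 by rewrite mul0mx.
  apply/rowP => q; rewrite !mxE; under eq_bigr do rewrite !mxE mulrDl -mulrA.
  rewrite big_split /= -big_distrr /= HX //; apply: yq.
  by rewrite ltnS ltnW.
have zp p : y 0 (widen_ord (leqnSn m) p) = - (l * X p).
  by move/rowP/(_ p): z0; rewrite !mxE => /eqP; rewrite addr_eq0 => /eqP.
have l0 : l = 0.
  have := yq m (ltnSn m); under eq_bigr do rewrite zp mulNr -mulrA.
  rewrite sumrN -big_distrr /= addrC -mulrBr => /eqP.
  by rewrite mulf_eq0 (negbTE s0) orbF => /eqP.
apply/rowP => p; rewrite mxE; have [pm|mp] := ltnP p m.
  have := zp (Ordinal pm); rewrite l0 mul0r oppr0 => <-.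
  by congr (y 0 _); exact: val_inj.
rewrite -[RHS]l0; congr (y 0 _); apply: val_inj => /=.
by apply/eqP; rewrite eqn_leq mp -ltnS ltn_ord.
Qed.

(** One step of Gaussian elimination. If X and Y solve for rows i and m, and l is the multiplier,
    then (X - l Y, l) solves for row i in the larger block. *)
Lemma schurS A m i j : lead A m \in unitmx -> lead A m.+1 \in unitmx ->
  schur A m.+2 i.+1 j.+1 = schur A m.+1 i.+1 j.+1 -
    schur A m.+1 i.+1 m.+1 / schur A m.+1 m.+1 m.+1 * schur A m.+1 m.+1 j.+1.
Proof.
move=> U U'; have s0 := pivot_neq0 U U'.
have [X HX] := row_sol_ex i U; have [Y HY] := row_sol_ex m U.
set l := _ / _.
pose X' p := if (p < m)%N then X p - l * Y p else l.
have X'E q : \sum_(p < m.+1) X' p * ent A p q =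
    \sum_(p < m) X p * ent A p q
    + l * (ent A m q - \sum_(p < m) Y p * ent A p q).
  rewrite big_ord_recr /= {2}/X' ltnn.
  under eq_bigr do rewrite /X' ltn_ord mulrBl -mulrA.
  by rewrite sumrB -big_distrr /=; ring.
have HX' : row_sol A m.+1 i X'.
  move=> q; rewrite ltnS leq_eqVlt => /orP[/eqP->|qm]; rewrite X'E.
    rewrite -(schurE m U HY) /l divfK // (schurE m U HX); ring.
  by rewrite HX // HY //; ring.
by rewrite (schurE j U' HX') X'E (schurE j U HX) (schurE j U HY); ring.
Qed.

Lemma entE A (i j : 'I_n) : ent A i j = A i j.
Proof. by rewrite /ent !valK. Qed.

End Schur.

(** * Max norm, and the growth factor under complete pivoting *)

Section MaxNorm.
Variables (R : realType) (m n : nat).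
Implicit Types M : 'M[R]_(m, n).

Lemma maxnorm_ge M i j : `|M i j| <= maxnorm M.
Proof.
apply: le_trans (le_bigmax _ _ i) => /=.
exact: (le_bigmax _ (fun j => `|M i j|) j).
Qed.

Lemma maxnorm_le M c : 0 <= c -> (forall i j, `|M i j| <= c) -> maxnorm M <= c.
Proof.
by move=> c0 h; apply: bigmax_le => // i _; apply: bigmax_le => // j _.
Qed.

End MaxNorm.

Section Growth.
Variable R : realType.

(** Complete pivoting bounds the entries of L by 1 and each row of U by its pivot; the last row of U
    consists of its pivot alone. *)
Lemma growth_le (n : nat) (A : 'M[R]_n.+1) (c : R) :
  completely_pivoted A -> 1 <= maxnorm A -> 1 <= c ->
  (forall k, (k <= n)%N -> `|schur A k.+1 k.+1 k.+1| <= c) -> growth A <= c.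
Proof.
move=> cp A1 c1 piv; have c0 : 0 <= c := le_trans ler01 c1.
have A0 : 0 < maxnorm A := lt_le_trans ltr01 A1.
rewrite /growth ge_max; apply/andP; split.
  apply: maxnorm_le => // i j; rewrite mxE; case: eqP => [_|ij].
    by rewrite normr1.
  case: ifP => ji; last by rewrite normr0.
  apply: le_trans c1; rewrite normrM normfV.
  have jn : (j < n)%N by rewrite (leq_trans ji) // -ltnS.
  have h : `|schur A j.+1 i.+1 j.+1| <= `|schur A j.+1 j.+1 j.+1|.
    by apply: cp => //; rewrite ?ltnS ?leqnn ?(ltnW ji) //= -ltnS.
  (* Invertibility is not assumed here; for a zero pivot the quotient is 0 by convention. *)
  have [->|s0] := eqVneq (schur A j.+1 j.+1 j.+1) 0.
    by rewrite normr0 invr0 mulr0.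
  by rewrite ler_pdivrMr ?normr_gt0 // mul1r.
rewrite ler_pdivrMr //; apply: le_trans (_ : c <= _); last first.
  by rewrite ler_peMr.
apply: maxnorm_le => // i j; rewrite mxE.
case: ifP => ij; last by rewrite normr0.
have ni : (i <= n)%N by rewrite -ltnS.
have nj : (j <= n)%N by rewrite -ltnS.
apply: le_trans (piv i ni); have [iN|iN] := ltnP i n.
  by apply: cp => //; rewrite ?ltnS ?leqnn //= ij.
suff -> : i = j :> nat by [].
by apply/eqP; rewrite eqn_leq ij (leq_trans nj).
Qed.

End Growth.

(** * From the matrices to the curve and back *)

Section Elimination.
Variable R : realType.

(** Here y = A_41, al = A_13, be = A_15, b = A2_23, q = A3_33, and t = A2_42 / A2_22, m = A3_53 / q
    are multipliers. Hypotheses [e5] to [e8] are the four prescribed expressions of r = A4_44. The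
    last two of these determine m and r, the first two determine t and y, and [e9] becomes the
    equation of the curve. *)
Lemma elimination_curve (u x y al be t b m q r : R) :
  -1 <= u <= 1 -> 1 + u != 0 -> -1 <= x <= 1 -> `|t| <= 1 -> `|b| <= 1 + u ->
  y * al = - u ->
  (1 + x) * be = 2 - q ->
  q = 2 - u * (u + x) ->
  t * b = 1 + u - q ->
  r = 1 + y * u - t * (-1 + x * u) + u * (1 + x) ->
  r = 1 - y * be - t * (1 - x * be) + q ->
  r = q - m * (u * (1 + x)) ->
  r = 2 - (u + x) * be + m * q ->
  m * q = 1 - u * al + b ->
  `|q| <= 4 /\
  (`|r| <= 2 \/
   exists v, [/\ 0 <= u <= 1, 0 <= v <= 1 / 9, r = 2 + 2 * v & Hf u v = 0]).
Proof.
move=> /andP[um1 u1] pn0 /andP[xm1 x1] tle ble e1 e2 e3 e4 e5 e6 e7 e8 e9.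
have p0 : 0 < 1 + u by rewrite lt_def pn0; lra.
have tb : `|1 + u - q| <= 1 + u.
  by rewrite -e4 normrM -[leRHS]mul1r ler_pM.
have /andP[qlo qhi] : 0 <= q <= 2 * (1 + u).
  by move: tb; rewrite ler_norml => /andP[h1 h2]; apply/andP; split; lra.
(* For u < 0 the bound q <= 2 (1 + u) would read (-u) (u + x + 2) <= 0, whereas both factors are
   positive. *)
have u0 : 0 <= u.
  rewrite leNgt; apply/negP => u0.
  have : 0 < (- u) * (u + x + 2) by rewrite mulr_gt0 //; lra.
  by nra.
pose W := Wf u; pose n := u * (u + x).
have WE : W = (2 - u) * (1 + u) by rewrite /W /Wf; ring.
have W0 : 0 < W by rewrite WE mulr_gt0 //; lra.
have Wn0 : W != 0 by rewrite gt_eqF.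
have mW : m * W = - (u + x) * (u - be).
  have <- : q + u * (1 + x) = W by rewrite e3 /W /Wf; ring.
  have h : q - m * (u * (1 + x)) = 2 - (u + x) * be + m * q by rewrite -e7 -e8.
  have -> : m * (q + u * (1 + x)) = q - 2 + (u + x) * be by lra.
  by rewrite e3; ring.
have ben : (1 + x) * be = n by rewrite e2 e3 /n; ring.
have rW : r * W = 2 * W - 2 * n.
  have -> : r * W = q * W - u * (1 + x) * (m * W) by rewrite e7; ring.
  have -> : u * (1 + x) * (m * W) = - n * (u * (1 + x) - (1 + x) * be).
    by rewrite mW /n; ring.
  by rewrite ben e3 /n /W /Wf; ring.
split; first by rewrite ger0_norm //; lra.
pose v := - n / W.
have vW : v * W = - n by rewrite divfK.
have rE : r = 2 + 2 * v.
  apply: (mulIf Wn0); have -> : (2 + 2 * v) * W = 2 * W + 2 * (v * W) by ring.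
  by rewrite rW vW; ring.
have ux : 0 <= u * (1 + x) by rewrite mulr_ge0 //; lra.
have [n0|n0] := leP 0 n.
  left; rewrite rE ler_norml.
  have v0 : v <= 0 by rewrite pmulr_lle0 ?invr_gt0 // oppr_le0.
  suff : -2 <= v by move=> ?; apply/andP; split; lra.
  rewrite ler_pdivlMr // WE /n.
  have : 0 <= u * (1 - x) by rewrite mulr_ge0 //; lra.
  have : 0 <= (1 + u) * (1 - u) by rewrite mulr_ge0 //; lra.
  by nra.
right; exists v.
have v0 : 0 < v by rewrite divr_gt0 // oppr_gt0.
split=> //; first by rewrite u0.
  rewrite (ltW v0) /= ler_pdivrMr // /n /W /Wf.
  (* For given u the worst case is x = -1, where v = u (1 - u) / W; its maximum 1/9 is reached at u
     = 1/2, and the inequality becomes 2 (2u - 1)^2 >= 0. *)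
  have := sqr_ge0 (2 * u - 1); rewrite expr2; nra.
have nE : n = - (v * W) by rewrite vW opprK.
have BE : Bf u v = u * (1 + x).
  rewrite /Bf -/W mulrBr mulr1 [W * v]mulrC vW /n /W /Wf; ring.
have W2E : W - 2 = u * (1 - u) by rewrite /W /Wf; ring.
have vWE : v * W = W - 2 - u * (1 + x) by rewrite vW W2E /n; ring.
(* Both expressions for [r] involve [y] only through [w := y - t x]. *)
pose w := y - t * x.
have w1 : u * w + t = 1 + 2 * v - u * (1 + x) by rewrite /w; lra.
have w2 : (u + be) * w + 2 * t = q - u * (1 + x) by rewrite /w; lra.
have wE : (W - 2) * w = - (1 + x) * (W - 2 - 4 * v).
  have -> : (W - 2) * w = - ((1 + x) * be - u * (1 + x)) * w.
    by rewrite ben W2E /n; ring.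
  have h : (be - u) * w = W - 2 - 4 * v.
    have -> : (be - u) * w = (u + be) * w + 2 * t - 2 * (u * w + t) by ring.
    by rewrite w1 w2 e3 /W /Wf; ring.
  by rewrite -h; ring.
have tE : t * (W - 2) = Tf u v.
  have -> : t * (W - 2) = (u * w + t) * (W - 2) - u * ((W - 2) * w) by ring.
  rewrite w1 wE /Tf -/W.
  have -> : 4 * (v * v) * W = 4 * v * (v * W) by ring.
  by rewrite vWE; ring.
have yE : y * (u * (W - 2)) = Yf u v.
  have -> : y * (u * (W - 2))
      = u * ((W - 2) * w) + (u * (1 + x) - u) * (t * (W - 2)).
    by rewrite /w; ring.
  rewrite wE tE /Yf BE -/W.
  have -> : 2 * v * W = 2 * (v * W) by ring.
  have -> : Tf u v = (W - 2) * (1 - 2 * v) + 4 * v * (v * W).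
    by rewrite /Tf -/W; ring.
  by rewrite vWE; ring.
have mB : m * (u * (1 + x)) = v * (W - 2).
  apply: (mulIf Wn0).
  have -> : m * (u * (1 + x)) * W = (m * W) * (u * (1 + x)) by ring.
  have -> : v * (W - 2) * W = (v * W) * (W - 2) by ring.
  rewrite mW vW.
  have -> : - (u + x) * (u - be) * (u * (1 + x))
      = - n * (u * (1 + x) - (1 + x) * be) by rewrite /n; ring.
  by rewrite ben W2E /n; ring.
have qE : q = 2 + v * W by rewrite vW e3 /n; ring.
(* This is [e9] times t y; the products y al and t b are known from [e1] and [e4], which removes al
   and b. *)
have key : t * y * (m * q) = t * y + u * u * t + (u - 1 - W * v) * y.
  have -> : (u - 1 - W * v) = t * b by rewrite e4 qE; ring.
  have -> : u * u * t = - u * (y * al) * t by rewrite e1; ring.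
  by rewrite e9; ring.
(* Multiplying [key] by u (1 + x) u (W - 2)^2 turns t, y and m into T, Y and v (W - 2) without
   dividing. *)
have : (t * (W - 2)) * (y * (u * (W - 2))) * (m * (u * (1 + x)) * q)
    = u * (1 + x) * ((t * (W - 2)) * (y * (u * (W - 2)))
      + (W - 2) * (u * (u * u) * (t * (W - 2))
                   + (u - 1 - W * v) * (y * (u * (W - 2))))).
  have -> : (t * (W - 2)) * (y * (u * (W - 2))) * (m * (u * (1 + x)) * q)
    = u * (1 + x) * u * (W - 2) * (W - 2) * (t * y * (m * q)) by ring.
  by rewrite key; ring.
rewrite tE yE mB -BE qE /Hf /Zf -/W => h.
by apply/eqP; rewrite -subr_eq0; apply/eqP; lra.
Qed.
End Elimination.

Section UpperBound.
Variable R : realType.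

Lemma inS_growth_le (A : 'M[R]_5) (c : R) : inS A -> 4 <= c ->
  (forall u v, 0 <= u <= 1 -> 0 <= v <= 1 / 9 -> Hf u v = 0 ->
     4 + 4 * v <= c) ->
  growth A <= c.
Proof.
move=> [li [cp [F [E2 [E3 E4]]]]] c4 bound.
have U0 := lead0_unit A.
have [U1 U2 U3 U4] : [/\ lead A 1 \in unitmx, lead A 2 \in unitmx,
    lead A 3 \in unitmx & lead A 4 \in unitmx] by split; exact: li.
have c1 i j : (i <= 4)%N -> (j <= 4)%N -> `|ent A i j| <= 1.
  move=> hi hj; have := cp 1%N i.+1 j.+1 isT isT hi hj.
  by rewrite !schur1; case: F => -> _; rewrite normr1.
have maxA : 1 <= maxnorm A.
  have := maxnorm_ge A 0 0; rewrite -entE; case: F => -> _.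
  by rewrite normr1.
have p0 := pivot_neq0 U1 U2; have q0 := pivot_neq0 U2 U3.
have r0 := pivot_neq0 U3 U4.
have S2 i j : schur A 2 i.+1 j.+1 = ent A i j - ent A i 0 * ent A 0 j.
  by rewrite schurS // !schur1; case: F => -> _; rewrite divr1.
have S3 i j := schurS i j U1 U2; have S4 i j := schurS i j U2 U3.
have S5 i j := schurS i j U3 U4.
have cp2 i j : (1 <= i <= 4)%N -> (1 <= j <= 4)%N ->
    `|schur A 2 i.+1 j.+1| <= `|schur A 2 2 2|.
  by move=> hi hj; apply: cp.
case: F => a00 [a01 [a13 [a14 [a20 [a23 [a24 F]]]]]].
case: F => a32 [a33 [a34 [a41 [a42 [a43 a44]]]]].
case: E2 => e32 [e34 [e43 e52]].
case: E3 => e35 [e3_43 e54]; case: E4 => e45 [e4_54 e4_55].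
set p := schur A 2 2 2 in p0 e32 e34 e43 e52 S3 cp2.
set q := schur A 3 3 3 in q0 e35 e3_43 e54 S4.
set r := schur A 4 4 4 in r0 e45 e4_54 e4_55 S5.
(* After the first column, these are the only multipliers that the equalities do not fix as 1 or
   -1. *)
pose t := schur A 2 4 2 / p; pose m := schur A 3 5 3 / q.
have R3 j : schur A 3 3 j.+1 = schur A 2 3 j.+1 - schur A 2 2 j.+1.
  by rewrite S3 e32 divff // mul1r.
have R4 j : schur A 3 4 j.+1 = schur A 2 4 j.+1 - t * schur A 2 2 j.+1.
  by rewrite S3.
have R5 j : schur A 3 5 j.+1 = schur A 2 5 j.+1 + schur A 2 2 j.+1.
  by rewrite S3 e52 mulNr divff // mulN1r opprK.
have Q4 j : schur A 4 4 j.+1 = schur A 3 4 j.+1 - schur A 3 3 j.+1.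
  by rewrite S4 e3_43 divff // mul1r.
have Q5 j : schur A 4 5 j.+1 = schur A 3 5 j.+1 - m * schur A 3 3 j.+1.
  by rewrite S4.
have U55 : schur A 5 5 5 = 2 * r.
  by rewrite S5 e4_54 e4_55 e45 mulNr divff //; ring.
set x := ent A 1 0 in S2; set y := ent A 3 0; set al := ent A 0 2.
set be := ent A 0 4.
pose u := p - 1.
(* Since u occurs as an entry of A, pivoting at the first step gives |u| <= 1. *)
have zE : ent A 4 0 = u by move: e52; rewrite S2 a41 a01 /u; lra.
have a03E : ent A 0 3 = - u by move: e34; rewrite S2 a23 a20 /u; lra.
have [q4 rb] : `|q| <= 4 /\ (`|r| <= 2 \/ exists v,
    [/\ 0 <= u <= 1, 0 <= v <= 1 / 9, r = 2 + 2 * v & Hf u v = 0]).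
  have uE : 1 + u = p by rewrite /u; ring.
  have ub : -1 <= u <= 1 by rewrite -ler_norml -zE c1.
  have pp : `|p| = 1 + u by rewrite -uE ger0_norm //; case/andP: ub; lra.
  apply: (@elimination_curve R u x y al be t (schur A 2 2 3) m q r) => //.
  - by rewrite uE.
  - by rewrite -ler_norml c1.
  - rewrite normrM normfV ler_pdivrMr ?normr_gt0 // mul1r.
    exact: (cp2 3%N 1%N).
  - rewrite -pp; exact: (cp2 1%N 2%N).
  - move: e43; rewrite S2 a32 -/y -/al /u; lra.
  - move: e35; rewrite R3 !S2 a24 a20 a14 -/x -/be; lra.
  - move: e54; rewrite R5 !S2 a43 a13 a03E zE -/x; lra.
  - move: e3_43; rewrite R4 e43; lra.
  - rewrite /r Q4 R4 R3 e34 !S2 a33 a13 a03E -/x -/y; rewrite -uE; ring.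
  - rewrite -e45 Q4 R4 e35 !S2 a34 a14 -/x -/y -/be; ring.
  - move: e4_54; rewrite Q5 e54 R3 e34 !S2 a13 a03E -/x -uE; lra.
  - rewrite -e4_55 Q5 R5 e35 !S2 a44 a14 zE -/x -/be; ring.
  - by rewrite divfK // R5 !S2 a42 zE -/al; ring.
have r2 : 2 * `|r| <= c.
  case: rb => [|[v [hu hv -> /(bound _ _ hu hv)]]]; first by lra.
  by case/andP: hv => v0 _; rewrite ger0_norm; lra.
apply: (growth_le cp maxA); first by lra.
move=> [|[|[|[|[|//]]]]] _.
- by rewrite schur1 a00 normr1; lra.
- rewrite -/p (_ : p = 1 + u); last by rewrite /u; ring.
  have : `|u| <= 1 by rewrite -zE c1.
  by have := ler_normD 1 u; rewrite normr1; lra.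
- by rewrite -/q; lra.
- by rewrite -/r; have := normr_ge0 r; lra.
- by rewrite U55 normrM ger0_norm.
Qed.

End UpperBound.

(** * Solving back from a point of the curve *)

Section CurvePoint.
Variable R : realType.

(** The substitutions of [elimination_curve] are inverted, every denominator being nonzero in the
    box. The numerical ranges serve to verify the pivoting inequalities. *)
Lemma curve_point (u v : R) :
  42 / 100 < u < 49 / 100 -> 33 / 1000 <= v < 83 / 2500 -> Hf u v = 0 ->
  exists x y al be t b m q,
  [/\ [/\ y * al = - u, (1 + x) * be = 2 - q, q = 2 - u * (u + x)
        & t * b = 1 + u - q],
      [/\ 2 + 2 * v = 1 + y * u - t * (-1 + x * u) + u * (1 + x),
          2 + 2 * v = 1 - y * be - t * (1 - x * be) + q,
          2 + 2 * v = q - m * (u * (1 + x)),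
          2 + 2 * v = 2 - (u + x) * be + m * q & m * q = 1 - u * al + b]
    & [/\ -1 < b + x * al /\ -67 / 100 <= x <= - 57 / 100,
          -81 / 100 <= y <= -75 / 100 /\ 96 / 100 <= t <= 98 / 100,
          51 / 100 <= al <= 66 / 100 /\ -24 / 100 <= be <= - 17 / 100,
          -69 / 100 <= b <= -59 / 100 /\ 0 <= m <= 8 / 100
        & 207 / 100 <= q <= 208 / 100]].
Proof.
move=> hu hv H0; have hu' : 42 / 100 <= u <= 49 / 100.
  by case/andP: hu => *; rewrite !ltW.
have hv' : 33 / 1000 <= v <= 83 / 2500.
  by case/andP: hv => -> v1; rewrite ltW.
move: (Tf_bounds hu' hv') (Yf_bounds hu' hv') (entry23_gtN1 hu' hv') H0.
move: hu' hv' {hu hv} => /andP[u0 u1] /andP[v0 v1].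
have : Wf u - 2 = u * (1 - u) by rewrite /Wf; ring.
have : Bf u v = Wf u - 2 - v * Wf u by rewrite /Bf; ring.
have : Yf u v = - 2 * v * Bf u v * (Wf u - 4 - 2 * v * Wf u) - u * Tf u v by [].
have : Tf u v = (Wf u - 2) * (1 - 2 * v) + 4 * v * (v * Wf u).
  by rewrite /Tf; ring.
rewrite /Hf /Zf; move: (Wf u) (Tf u v) (Yf u v) (Bf u v) => W T Y B.
move=> TE YE BE W2E /andP[T0 T1] /andP[Y0 Y1] eb H0.
have [W2lo W2hi] : 243 / 1000 < W - 2 /\ W - 2 <= 1 / 4.
  move: u0 u1; rewrite W2E; clear=> u0 u1; split; first by nra.
  by have := sqr_ge0 (2 * u - 1); rewrite expr2; lra.
have [vWlo vWhi] : 74 / 1000 <= v * W /\ v * W <= 75 / 1000.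
  by move: v0 v1 W2lo W2hi; clear=> *; split; nra.
have [B0 B1] : 168 / 1000 <= B /\ B <= 176 / 1000.
  by rewrite BE; move: vWlo vWhi W2lo W2hi; clear=> *; split; lra.
have up : 0 < u by move: u0; clear; lra.
have W2p : 0 < W - 2 by move: W2lo; clear; lra.
have Bp : 0 < B by move: B0; clear; lra.
have Tp : 0 < T by move: T0 W2p; clear; lra.
have uWp : 0 < u * (W - 2) by rewrite mulr_gt0.
have Yn : Y < 0 by move: Y0 uWp; clear; lra.
have un0 : u != 0 by rewrite gt_eqF.
have W2n0 : W - 2 != 0 by rewrite gt_eqF.
have Bn0 : B != 0 by rewrite gt_eqF.
have Tn0 : T != 0 by rewrite gt_eqF.
have Yn0 : Y != 0 by rewrite lt_eqF.
pose x := B / u - 1; pose y := Y / (u * (W - 2)); pose al := - u / y.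
pose be := - (v * W) * u / B; pose t := T / (W - 2).
pose b := (u - 1 - W * v) / t; pose m := v * (W - 2) / B; pose q := 2 + v * W.
have tn0 : t != 0 by rewrite mulf_neq0 ?invr_eq0.
have yn0 : y != 0 by rewrite mulf_neq0 ?invr_eq0 // mulf_neq0.
have xB : u * (1 + x) = B by rewrite /x; field.
have tT : t * (W - 2) = T by rewrite divfK.
have yY : y * u * (W - 2) = Y by rewrite /y; field; apply/andP.
have beB : (1 + x) * be = - (v * W) by rewrite /be /x; field; apply/andP.
have nE : u * (u + x) = - (v * W).
  have -> : u * (u + x) = u * (1 + x) - u * (1 - u) by ring.
  by rewrite xB BE W2E; ring.
exists x, y, al, be, t, b, m, q; split.
- split.
  + by rewrite /al; field.
  + by rewrite beB /q; ring.
  + by rewrite nE /q; ring.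
  + by rewrite /b mulrCA divff // mulr1 /q; ring.
- split.
  + apply: (mulIf W2n0).
    have -> : (1 + y * u - t * (-1 + x * u) + u * (1 + x)) * (W - 2) =
        W - 2 + y * u * (W - 2) - t * (W - 2) * (u * (1 + x) - u - 1)
        + u * (1 + x) * (W - 2) by ring.
    rewrite tT yY xB YE TE BE; ring.
  + apply: (mulIf W2n0).
    have -> : (1 - y * be - t * (1 - x * be) + q) * (W - 2) =
        (1 + q) * (W - 2) - (y * u * (W - 2) - u * x * (t * (W - 2))) * (be / u)
          - t * (W - 2) by field.
    have -> : u * x = B - u by rewrite -xB; ring.
    have -> : be / u = - (v * W) / B by rewrite /be; field; apply/andP.
    rewrite tT yY YE /q.
    have -> : (- 2 * v * B * (W - 4 - 2 * v * W) - u * T - (B - u) * T)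
        * (- (v * W) / B) = (2 * v * (W - 4 - 2 * v * W) + T) * (v * W) by field.
    by rewrite TE; ring.
  + by rewrite xB /m /q divfK //; ring.
  + have -> : (u + x) * be = - (v * W) * (be / u) by rewrite -nE; field.
    have -> : be / u = - (v * W) / B by rewrite /be; field; apply/andP.
    rewrite /m /q; apply: (mulIf Bn0).
    have -> : (2 - - (v * W) * (- (v * W) / B) + v * (W - 2) / B * (2 + v * W))
       * B = 2 * B - v * W * (v * W) + v * (W - 2) * (2 + v * W) by field.
    by rewrite BE; ring.
  + apply/eqP; rewrite -subr_eq0; apply/eqP.
    have -> : al = - u * (u * (W - 2)) / Y.
      by rewrite /al /y; field; rewrite un0 Yn0 W2n0.
    have -> : b = (u - 1 - W * v) * (W - 2) / T.
      by rewrite /b /t; field; rewrite Tn0 W2n0.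
    (* The defect of the last equation is -H(u, v) / (T Y B). *)
    transitivity (- (T * Y * (B - v * (W - 2) * (2 + W * v)) + B * (W - 2) *
        (u * (u * u) * T + (u - 1 - W * v) * Y)) / (T * Y * B)).
      by rewrite /m /q; field; rewrite Bn0 Yn0 Tn0.
    by rewrite H0 oppr0 mul0r.
- have [x0 x1] : -67 / 100 <= x /\ x <= -57 / 100.
    rewrite /x; split.
      by rewrite lerBrDr ler_pdivlMr //; move: u1 B0; clear; lra.
    by rewrite lerBlDr ler_pdivrMr //; move: u0 B1; clear; lra.
  have [t0 t1] : 96 / 100 <= t /\ t <= 98 / 100.
    rewrite /t ler_pdivlMr // ler_pdivrMr //.
    by move: T0 T1; clear=> *; split; lra.
  have [y0 y1] : -81 / 100 <= y /\ y <= -75 / 100.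
    rewrite /y ler_pdivlMr // ler_pdivrMr //.
    by move: Y0 Y1; clear=> *; split; lra.
  have yneg : y < 0 by move: y1; clear; lra.
  have tp : 0 < t by move: t0; clear; lra.
  split.
  + split; last by rewrite x0.
    have tyn : t * y < 0 by rewrite pmulr_rlt0.
    rewrite -subr_gt0 -(nmulr_rlt0 _ tyn).
    have -> : t * y * (b + x * al - -1) =
        ((u - 1 - W * v) * Y * (W - 2) - u * x * u * T * (W - 2) + T * Y)
        / (u * (W - 2) * (W - 2)).
      rewrite -tT -yY /b /al; field.
      by rewrite un0 W2n0 tn0 yn0.
    rewrite pmulr_llt0 ?invr_gt0 ?mulr_gt0 //.
    have -> : u * x = - (W * v + u * u).
      by have := nE; move: (x); clear=> ?; lra.
    by move: eb; clear; lra.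
  + by rewrite y0 y1 t0 t1.
  + split; apply/andP; split.
    * by rewrite /al ler_ndivlMr //; move: u0 y0; clear; lra.
    * by rewrite /al ler_ndivrMr //; move: u1 y1; clear; lra.
    * by rewrite /be ler_pdivlMr //; move: u1 v1 vWhi B0 up; clear; nra.
    * by rewrite /be ler_pdivrMr //; move: u0 v1 vWlo B1 up; clear; nra.
  + split; apply/andP; split.
    * by rewrite /b ler_pdivlMr //; move: u0 vWhi t0; clear; lra.
    * by rewrite /b ler_pdivrMr //; move: u1 vWlo t1; clear; lra.
    * by rewrite /m divr_ge0 ?mulr_ge0 ?ltW //; move: v0; clear; lra.
    * by rewrite /m ler_pdivrMr //; move: v0 v1 W2lo W2hi B0; clear; nra.
  + by rewrite /q; move: vWlo vWhi; clear=> *; apply/andP; split; lra.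
Qed.
End CurvePoint.

Local Ltac norm_lra := rewrite ler_norml; apply/andP; split; lra.

(** * The extremal matrix *)

Section Extremal.
Variable R : realType.

Definition table_mx (n : nat) (rows : seq (seq R)) : 'M[R]_n :=
  \matrix_(i < n, j < n) nth 0 (nth [::] rows i) j.

Lemma ent_table_mx n rows i j : (i < n)%N -> (j < n)%N ->
  ent (table_mx n rows) i j = nth 0 (nth [::] rows i) j.
Proof.
move=> hi hj.
by rewrite -[i]/(val (Ordinal hi)) -[j]/(val (Ordinal hj)) entE mxE.
Qed.

(** Positions outside the table read the default 0, so no range condition on i and j is required. *)
Lemma table_le (rows : seq (seq R)) c i j : 0 <= c ->
  all (all (fun e => `|e| <= c)) rows -> `|nth 0 (nth [::] rows i) j| <= c.
Proof.
move=> c0 h; have [hi|hi] := ltnP i (size rows); last first.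
  by rewrite (nth_default _ hi) nth_nil normr0.
have /(all_nthP 0) h' := all_nthP [::] h i hi.
have [hj|hj] := ltnP j (size (nth [::] rows i)); first exact: h'.
by rewrite nth_default // normr0.
Qed.

Lemma growth_attained (u v : R) :
  42 / 100 < u < 49 / 100 -> 33 / 1000 <= v < 83 / 2500 -> Hf u v = 0 ->
  exists A : 'M[R]_5, inS A /\ growth A = 4 + 4 * v.
Proof.
move=> hu hv H0.
have [x [y [al [be [t [b [m [q]]]]]]]] := curve_point hu hv H0.
have [r rE] : exists r, r = 2 + 2 * v by exists (2 + 2 * v).
rewrite -!rE => -[[e1 e2 e3 e4] [e5 e6 e7 e8 e9] bounds] {H0}.
have [p pE] : exists p, p = 1 + u by exists (1 + u).
have [p0 q0 r0] : [/\ 0 < p, 0 < q & 0 < r].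
  case: bounds => _ _ _ _ /andP[q0 _]; case/andP: hu hv => u0 _ /andP[v0 _].
  by split; [move: u0 pE|move: q0|move: v0 rE]; clear; lra.
rewrite -pE in e4.
have [pd qd] : p / p = 1 /\ q / q = 1 by split; rewrite divff // gt_eqF.
pose A := table_mx 5
  [:: [:: 1; 1; al; - u; be];
      [:: x; p + x; b + x * al; -1; 1];
      [:: -1; u; q + b - al; -1; -1];
      [:: y; t * p + y; 1; 1; 1];
      [:: u; -1; 1; -1; 1]].
(* [M2], [M3] and [M4] list the expected A^(2), A^(3) and A^(4); once they are confirmed, complete
   pivoting is a finite check of table entries. *)
pose M2 :=
  [:: [:: p; b; -1 + x * u; 1 - x * be];
      [:: p; q + b; - p; be - 1];
      [:: t * p; p; 1 + y * u; 1 - y * be];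
      [:: - p; 1 - u * al; -1 + u * u; 1 - u * be]].
pose M3 :=
  [:: [:: q; - (u * (1 + x)); - q];
      [:: q; r - u * (1 + x); r - q];
      [:: m * q; - q; r - m * q]].
pose M4 := [:: [:: r; r]; [:: - r; r]].
have a i j : (i < 5)%N -> (j < 5)%N -> ent A i j = _ := @ent_table_mx 5 _ i j.
have U1 : lead A 1 \in unitmx.
  by apply: lead_unitS; rewrite ?lead0_unit // schur1 a //= oner_eq0.
have S2 i j : (i < 4)%N -> (j < 4)%N ->
    schur A 2 i.+2 j.+2 = nth 0 (nth [::] M2 i) j.
  move=> hi hj; rewrite schurS ?lead0_unit // !schur1 !a // divr1.
  by move: i j hi hj => [|[|[|[|//]]]] [|[|[|[|//]]]] _ _ /=;
    move: pE e1; clear=> *; lra.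
have U2 : lead A 2 \in unitmx by apply: lead_unitS; rewrite // S2 //= gt_eqF.
have S3 i j : (i < 3)%N -> (j < 3)%N ->
    schur A 3 i.+3 j.+3 = nth 0 (nth [::] M3 i) j.
  move=> hi hj; rewrite schurS // !S2 //.
  by move: i j hi hj => [|[|[|//]]] [|[|[|//]]] _ _ /=;
    rewrite ?mulNr -?[t * p / p]mulrA pd;
    move: pE e2 e3 e4 e5 e6 e8 e9; clear=> *; lra.
have U3 : lead A 3 \in unitmx by apply: lead_unitS; rewrite // S3 //= gt_eqF.
have S4 i j : (i < 2)%N -> (j < 2)%N ->
    schur A 4 i.+4 j.+4 = nth 0 (nth [::] M4 i) j.
  move=> hi hj; rewrite schurS // !S3 //.
  by move: i j hi hj => [|[|//]] [|[|//]] _ _ /=;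
    rewrite ?mulNr -?[m * q / q]mulrA qd; move: e7; clear=> *; lra.
have U4 : lead A 4 \in unitmx by apply: lead_unitS; rewrite // S4 //= gt_eqF.
have S5 : schur A 5 5 5 = 2 * r.
  by rewrite schurS // !S4 //= mulNr divff ?gt_eqF //; ring.
have cp : completely_pivoted A.
  move=> k i j k1 k4 /andP[ki i5] /andP[kj j5].
  have [h1 h2 h3 h4] : [/\
      all (all (fun e => `|e| <= 1))
        [:: [:: 1; 1; al; - u; be]; [:: x; p + x; b + x * al; -1; 1];
            [:: -1; u; q + b - al; -1; -1]; [:: y; t * p + y; 1; 1; 1];
            [:: u; -1; 1; -1; 1]],
      all (all (fun e => `|e| <= p)) M2,
      all (all (fun e => `|e| <= q)) M3 &
      all (all (fun e => `|e| <= r)) M4].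
    rewrite /= !normrN !normr1 !lexx !(gtr0_norm p0) !(gtr0_norm q0).
    rewrite !(gtr0_norm r0) !lexx /= !andbT.
    move: bounds hu hv => [[a12 /andP[x0 x1]] [/andP[y0 y1] /andP[t0 t1]]
      [/andP[al0 al1] /andP[be0 be1]] [/andP[b0 b1] /andP[m0 m1]] /andP[q1 q2]]
      /andP[u0 u1] /andP[v0 v1].
    have xal : x * al <= 0 by rewrite mulr_le0_ge0 //; move: x1 al0; clear; lra.
    have [tp0 tp1] : 96 / 100 * p <= t * p /\ t * p <= 98 / 100 * p.
      by rewrite !ler_pM2r.
    have [xu0 xu1] : - u <= x * u /\ x * u <= 0.
      by move: u0 x0 x1; clear=> *; split; nra.
    have [xbe0 xbe1] : 0 <= x * be /\ x * be <= 1.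
      by move: x0 x1 be0 be1; clear=> *; split; nra.
    have [yu0 yu1] : -1 <= y * u /\ y * u <= 0.
      by move: y0 y1 u0 u1; clear=> *; split; nra.
    have [ybe0 ybe1] : 0 <= y * be /\ y * be <= 1.
      by move: y0 y1 be0 be1; clear=> *; split; nra.
    have [ual0 ual1] : 0 <= u * al /\ u * al <= 1.
      by move: u0 u1 al0 al1; clear=> *; split; nra.
    have [uu0 uu1] : 0 <= u * u /\ u * u <= 1.
      by move: u0 u1; clear=> *; split; nra.
    have [ube0 ube1] : - (24 / 100) <= u * be /\ u * be <= 0.
      by move: u0 u1 be0 be1; clear=> *; split; nra.
    have [ux0 ux1] : 0 <= u * (1 + x) /\ u * (1 + x) <= 1.
      by move: u0 u1 x0 x1; clear=> *; split; nra.
    have [mq0 mq1] : 0 <= m * q /\ m * q <= 8 / 100 * q.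
      by rewrite mulr_ge0 ?ler_pM2r // ltW.
    (* By [e4], q + b = p + (1 - t) b with t < 1 and b < 0; the ranges of q, b and p overlap too
       much to give this directly. *)
    have qb : q + b <= p.
      have : (1 - t) * b <= 0.
        by rewrite mulr_ge0_le0 //; move: t1 b1; clear; lra.
      by move: e4; clear=> *; lra.
    have n0 : `|al| <= 1 by move: al0 al1; clear=> *; norm_lra.
    have n1 : `|u| <= 1 by move: u0 u1; clear=> *; norm_lra.
    have n2 : `|be| <= 1 by move: be0 be1; clear=> *; norm_lra.
    have n3 : `|x| <= 1 by move: x0 x1; clear=> *; norm_lra.
    have n4 : `|p + x| <= 1 by move: pE u0 u1 x0 x1; clear=> *; norm_lra.
    have n5 : `|b + x * al| <= 1 by move: a12 xal b1; clear=> *; norm_lra.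
    have n6 : `|q + b - al| <= 1.
      by move: q1 q2 b0 b1 al0 al1; clear=> *; norm_lra.
    have n7 : `|y| <= 1 by move: y0 y1; clear=> *; norm_lra.
    have n8 : `|t * p + y| <= 1.
      by move: tp0 tp1 pE u0 u1 y0 y1; clear=> *; norm_lra.
    have n9 : `|b| <= p by move: b0 b1 pE u0; clear=> *; norm_lra.
    have n10 : `|-1 + x * u| <= p by move: xu0 xu1 pE u0; clear=> *; norm_lra.
    have n11 : `|1 - x * be| <= p by move: xbe0 xbe1 pE u0; clear=> *; norm_lra.
    have n12 : `|q + b| <= p by move: qb q1 b0 pE u0; clear=> *; norm_lra.
    have n13 : `|be - 1| <= p by move: be0 be1 pE u0; clear=> *; norm_lra.
    have n14 : `|t * p| <= p by move: tp0 tp1 p0; clear=> *; norm_lra.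
    have n15 : `|1 + y * u| <= p by move: yu0 yu1 pE u0; clear=> *; norm_lra.
    have n16 : `|1 - y * be| <= p by move: ybe0 ybe1 pE u0; clear=> *; norm_lra.
    have n17 : `|1 - u * al| <= p by move: ual0 ual1 pE u0; clear=> *; norm_lra.
    have n18 : `|-1 + u * u| <= p by move: uu0 uu1 pE u0; clear=> *; norm_lra.
    have n19 : `|1 - u * be| <= p by move: ube0 ube1 pE u0; clear=> *; norm_lra.
    have n20 : `|u * (1 + x)| <= q by move: ux0 ux1 q1; clear=> *; norm_lra.
    have n21 : `|r - u * (1 + x)| <= q.
      by move: rE v0 v1 ux0 ux1 q1; clear=> *; norm_lra.
    have n22 : `|r - q| <= q by move: rE v0 v1 q1 q2; clear=> *; norm_lra.
    have n23 : `|m * q| <= q by move: mq0 mq1 q1; clear=> *; norm_lra.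
    have n24 : `|r - m * q| <= q.
      by move: rE v0 v1 mq0 mq1 q1 q2; clear=> *; norm_lra.
    by rewrite n0 n1 n2 n3 n4 n5 n6 n7 n8
      n9 n10 n11 n12 n13 n14 n15 n16 n17 n18 n19
      n20 n21 n22 n23 n24.
  move: k i j k1 k4 ki i5 kj j5 => [//|[|[|[|[|//]]]]] [|i] [|j] // _ _ ki i5 kj j5.
  - by rewrite !schur1 !a //= normr1; exact: table_le.
  - move: i j ki i5 kj j5 => [//|i] [//|j] _ i5 _ j5.
    by rewrite !S2 //= (gtr0_norm p0) table_le // ltW.
  - move: i j ki i5 kj j5 => [//|[//|i]] [//|[//|j]] _ i5 _ j5.
    by rewrite !S3 //= (gtr0_norm q0) table_le // ltW.
  - move: i j ki i5 kj j5 => [//|[//|[//|i]]] [//|[//|[//|j]]] _ i5 _ j5.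
    by rewrite !S4 //= (gtr0_norm r0) table_le // ltW.
have A1 : maxnorm A = 1.
  apply/eqP; rewrite eq_le; apply/andP; split.
    apply: maxnorm_le => // i j; have := cp 1%N i.+1 j.+1 isT isT.
    rewrite !schur1 entE (a 0 0)%N //= normr1; apply; exact: ltn_ord.
  by have := maxnorm_ge A 0 0; rewrite -entE a //= normr1.
exists A; split.
  split; first by move=> [//|[|[|[|[|//]]]]].
  split=> //; split; first by rewrite !a.
  by rewrite !S2 //= !S3 //= !S4.
have -> : 4 + 4 * v = 2 * r by rewrite rE; ring.
apply/eqP; rewrite eq_le; apply/andP; split.
  have [r2 q2 p2] : [/\ 2 < r, q <= 208 / 100 & p <= 2].
    case: bounds hu hv => _ _ _ _ /andP[_ q2] /andP[_ u1] /andP[v0 _].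
    by split=> //; [move: rE v0|move: pE u1]; clear; lra.
  apply: growth_le => //; rewrite ?A1 //; first by move: r2; clear; lra.
  move=> [|[|[|[|[|//]]]]] _.
  - by rewrite schur1 a //= normr1; move: r2; clear; lra.
  - by rewrite S2 //= gtr0_norm //; move: r2 p2; clear; lra.
  - by rewrite S3 //= gtr0_norm //; move: r2 q2; clear; lra.
  - by rewrite S4 //= gtr0_norm //; move: r0; clear; lra.
  - by rewrite S5 gtr0_norm ?mulr_gt0.
rewrite /growth A1 divr1 le_max; apply/orP; right.
have := maxnorm_ge (Ufac A) ord_max ord_max; rewrite mxE leqnn S5.
by rewrite gtr0_norm ?mulr_gt0.
Qed.

End Extremal.

(* max_{A in S} g(A) exists and equals the unique real root of P_5 in (4,5). *)
Theorem theorem1 (R : realType) :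
  exists r : R,
    [/\ 4 < r < 5, P5 r = 0,
        (forall s : R, 4 < s < 5 -> P5 s = 0 -> s = r),
        (exists A : 'M[R]_5, inS A /\ growth A = r)
      & (forall A : 'M[R]_5, inS A -> growth A <= r)].
Proof.
have [u [v [hu hv H0 P0 vmax]]] := curve_maximizer R.
have [v0 v1] := andP hv; exists (4 + 4 * v); split=> //.
- by move: v0 v1; clear=> *; apply/andP; split; lra.
- move=> s /andP[s4 s5] Ps.
  have sE : s = 4 + 4 * ((s - 4) / 4) by field.
  rewrite sE (@P5_shift_inj R ((s - 4) / 4) v) // -?sE ?Ps ?P0 //.
    by move: s4 s5; clear=> *; apply/andP; split; lra.
  by move: v0 v1; clear=> *; apply/andP; split; lra.
- exact: growth_attained hu hv H0.
move=> A SA; apply: inS_growth_le SA _ _; first by move: v0; clear; lra.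
move=> u' v' hu' /andP[v'0 v'1] H'.
suff : v' <= v by lra.
(* Maximality is known only in the strip; zeros below it lie under v because v >= 33/1000. *)
have [v'2|v'2] := leP (33 / 1000) v'; last by rewrite (le_trans (ltW v'2)).
by apply: (vmax u') => //; rewrite v'2.
Qed.
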